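(* Let $n>k$, where $k\in\{2,3,4,5\}$. Let $G$ be a $k$-connected graph on $n$ vertices, and let $H\subset G$ be a minimum spanning $k$-connected subgraph. If $e(H)=\lceil\frac{kn}{2}\rceil$, then \[ mc_k(G)=e(G)-\left\lceil\frac{kn}{2}\right\rceil+1. \]
   Context: All graphs are finite, simple and undirected. A graph is $k$-connected if it has at least $k+1$ vertices and remains connected after deleting any at most $k-1$ vertices. Paths are called disjoint if they are internally vertex-disjoint. An edge-coloured path is monochromatic if all its edges have the same colour. For a $k$-connected graph $G$, an edge-colouring is monochromatic $k$-connected if any two vertices are connected by $k$ disjoint monochromatic paths; $mc_k(G)$ is the maximum number of colours in a monochromatic $k$-connected colouring of $G$. A minimum spanning $k$-connected subgraph of $G$ is a $k$-connected subgraph $H$ with $V(H)=V(G)$ and $e(H)$ minimum among such subgraphs. *)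

(* Defs.v *)
From mathcomp Require Import all_boot.
Set Implicit Arguments. Unset Strict Implicit. Unset Printing Implicit Defensive.

Definition simple_graph (T : finType) (e : rel T) : Prop :=
  symmetric e /\ irreflexive e.

Definition edges (T : finType) (e : rel T) : {set {set T}} :=
  [set A : {set T} | [exists x, exists y, (A == [set x; y]) && e x y]].

Definition nedges (T : finType) (e : rel T) : nat := #|edges e|.

Definition connected_minus (T : finType) (e : rel T) (S : {set T}) : Prop :=
  forall x y, x \notin S -> y \notin S ->
    connect [rel u v | [&& e u v, u \notin S & v \notin S]] x y.

Definition k_connected (T : finType) (k : nat) (e : rel T) : Prop :=
  k < #|T| /\ forall S : {set T}, #|S| < k -> connected_minus e S.

Definition spanning_subgraph (T : finType) (h e : rel T) : Prop :=
  symmetric h /\ subrel h e.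

Definition min_spanning_k_connected (T : finType) (k : nat) (e h : rel T) : Prop :=
  spanning_subgraph h e /\ k_connected k h /\
  forall h' : rel T, spanning_subgraph h' e -> k_connected k h' ->
    nedges h <= nedges h'.

(* Edge colourings: a colour (nat) for every 2-set; only edges matter. *)
Definition colouring (T : finType) := {set T} -> nat.

Definition ncolours (T : finType) (e : rel T) (c : colouring T) : nat :=
  size (undup [seq c A | A <- enum (edges e)]).

Definition colour_rel (T : finType) (e : rel T) (c : colouring T) (a : nat) : rel T :=
  [rel u v | e u v && (c [set u; v] == a)].

(* s is the sequence of internal vertices of a monochromatic path
   x -> ... -> y (in some colour), with no repeated vertex. *)
Definition mono_path (T : finType) (e : rel T) (c : colouring T) (x y : T)
  (s : seq T) : Prop :=
  exists a : nat, path (colour_rel e c a) x (rcons s y) && uniq (x :: rcons s y).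

(* x and y are joined by k internally disjoint monochromatic paths
   (given by their interiors; distinct paths, pairwise disjoint interiors). *)
Definition k_mono_connected_pair (T : finType) (k : nat) (e : rel T)
  (c : colouring T) (x y : T) : Prop :=
  exists P : 'I_k -> seq T,
    injective P /\
    (forall i, mono_path e c x y (P i)) /\
    (forall i j, i != j -> forall v, v \in P i -> v \notin P j).

Definition mono_k_connected (T : finType) (k : nat) (e : rel T) (c : colouring T) : Prop :=
  forall x y : T, x != y -> k_mono_connected_pair k e c x y.

Definition mc_k_is (T : finType) (k : nat) (e : rel T) (m : nat) : Prop :=
  (exists c : colouring T, mono_k_connected k e c /\ ncolours e c = m) /\
  (forall c : colouring T, mono_k_connected k e c -> ncolours e c <= m).

(* Main.v *)
Require Import Defs.
From mathcomp Require Import all_boot.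
From mathcomp Require Import zify.
Set Implicit Arguments. Unset Strict Implicit. Unset Printing Implicit Defensive.

(** The lower bound colours H with one colour and every other edge with its own
    colour; Menger's theorem supplies the k disjoint paths inside H.

    For the upper bound, replace the colour classes by their connected
    components and let F_1, ..., F_t be those with at least two edges. Write
    d_i for the degree in F_i, D for the sum of the d_i, and E for the total
    number of edges of the F_i; one has to show 2E + 2 >= kn + 2t. The k paths
    from a vertex to a neighbour in some F_i leave it along distinct edges of
    the F_i, hence D >= k everywhere.

    If D > k everywhere, double counting the pairs joined inside each F_i
    gives the bound. Otherwise fix a tight vertex v, that is, D(v) = k. All
    other vertices have degree at least k - 1 in the classes through v, and the
    classes avoiding v pay for the vertices where this is k - 1. The excess of
    the classes through v suffices if v lies in one class or has degree one in
    some class, because a connected class has almost as many edges as vertices.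
    Since k <= 5, the only remaining case is a vertex v in exactly two classes,
    with degree 2 in F_1, say. Then either many vertices have D > k, or t = 2
    and F_1 is a Hamiltonian cycle; the two paths in F_1 from v to a neighbour
    then use up all vertices and leave no room for the paths in F_2. *)

(** * Menger's theorem *)

Section Menger.
Variable T : finType.
Implicit Types (g : rel T) (A B C S : {set T}) (a b c x y z : T) (s p : seq T).

Definition separates g A B S : Prop :=
  forall a s, a \in A -> path g a s -> last a s \in B -> has (mem S) (a :: s).

Definition path_between g A B p : bool :=
  if p is a :: s then [&& a \in A, path g a s, last a s \in B & uniq (a :: s)]
  else false.

(** [C] is only an index set and need not meet the paths; [linkage_reindex] later indexes them by
    their endpoints. *)
Definition linkage g A B C (P : T -> seq T) : Prop :=
  {in C, forall c, path_between g A B (P c)} /\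
  (forall c d z, c \in C -> d \in C -> z \in P c -> z \in P d -> c = d).

Definition del_arc g x y : rel T :=
  fun u v => g u v && ~~ ((u == x) && (v == y)).

Definition rev_rel g : rel T := fun u v => g v u.

Lemma sub_del_arc g x y : subrel (del_arc g x y) g.
Proof. by move=> u v /andP[]. Qed.

Lemma path_del_arc_notin g x y a s :
  path g a s -> x \notin a :: s -> path (del_arc g x y) a s.
Proof.
elim: s a => //= b s IH a /andP[gab gs]; rewrite inE negb_or => /andP[xa xbs].
by rewrite IH // andbT /del_arc gab eq_sym (negbTE xa).
Qed.

(** The path is cut at its first vertex in [X]: the arc leaving [x] could only be used after [X] has
    been reached. *)
Lemma path_del_arc_prefix g x y (X : {set T}) a s :
  x \in X -> path g a s -> has (mem X) (a :: s) ->
  exists s1, [/\ path (del_arc g x y) a s1, last a s1 \in X &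
                 {subset a :: s1 <= a :: s}].
Proof.
move=> xX; elim: s a => [|b s IH] a /=.
  by move=> _; rewrite orbF => aX; exists [::]; split.
case: (boolP (a \in X)) => [aX _ _|aX /andP[gab gs] /=].
  by exists [::]; split=> // z; rewrite !inE => ->.
move=> /(IH _ gs)[s1 [ps ls ss]].
exists (b :: s1); split=> //= [|z].
  rewrite ps andbT /del_arc gab /=; apply: contra aX => /andP[/eqP-> _]; exact: xX.
by rewrite inE => /orP[/eqP->|/ss zs]; rewrite inE ?eqxx // zs orbT.
Qed.

Lemma separates_add_source g x y A B S :
  separates (del_arc g x y) A B S -> separates g A B (x |: S).
Proof.
move=> sepS a s aA gs lB; case: (boolP (x \in a :: s)) => [xs|xs].
  by apply/hasP; exists x => //; rewrite /= setU11.
have /hasP[z zs zS] := sepS a s aA (path_del_arc_notin y gs xs) lB.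
by apply/hasP; exists z => //; rewrite /= setU1r.
Qed.

(** Every path from [A] to [B] meets [x |: S], and its piece up to the first such vertex avoids the
    deleted arc, hence meets [S']. *)
Lemma separates_del_arc g x y A B S S' :
  separates (del_arc g x y) A B S ->
  separates (del_arc g x y) A (x |: S) S' -> separates g A B S'.
Proof.
move=> sepS sepS' a s aA gs lB.
have [s1 [ps ls ss]] :=
  path_del_arc_prefix y (setU11 x S) gs (separates_add_source sepS aA gs lB).
have /hasP[z zs zS] := sepS' _ _ aA ps ls.
by apply/hasP; exists z => //; apply: ss.
Qed.

Lemma last_rev_belast a s b : last a s = b -> last b (rev (belast a s)) = a.
Proof. by case: s => [/= <- //|c s _]; rewrite /= rev_cons last_rcons. Qed.

Lemma mem_rev_belast a s : last a s :: rev (belast a s) =i a :: s.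
Proof. by move=> z; rewrite -rev_rcons -lastI mem_rev. Qed.

Lemma separates_rev g A B S : separates g A B S -> separates (rev_rel g) B A S.
Proof.
move=> sepS b s bB gs lA.
have := sepS (last b s) (rev (belast b s)) lA.
rewrite rev_path last_rev_belast // => /(_ gs bB) /hasP[z zs zS].
by apply/hasP; exists z => //; rewrite -mem_rev_belast.
Qed.

(** Disjoint paths have distinct endpoints, so sending a path to its endpoint is a bijection onto
    [B] and can be inverted. *)
Lemma linkage_reindex g A B C P :
  linkage g A B C P -> #|B| <= #|C| ->
  exists P', linkage g A B B P' /\ {in B, forall b, last b (P' b) = b}.
Proof.
move=> [PC Pdis] leBC; pose en c := last c (P c).
have en_in c : c \in C -> en c \in P c /\ en c \in B.
  move=> /PC; rewrite /en; case: (P c) => //= a s /and4P[_ _ ? _].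
  by split=> //; apply: mem_last.
have inj : {in C &, injective en}.
  move=> c d cC dC ecd; apply: (Pdis _ _ (en c) cC dC); first by case: (en_in _ cC).
  by rewrite ecd; case: (en_in _ dC).
have imB : en @: C = B.
  apply/eqP; rewrite eqEcard card_in_imset // leBC andbT.
  by apply/subsetP => _ /imsetP[c /en_in[_ ?] ->].
pose f b := odflt b [pick c in C | en c == b].
have fP b : b \in B -> f b \in C /\ en (f b) = b.
  rewrite -imB => /imsetP[c cC ->]; rewrite /f; case: pickP => [d /andP[-> /eqP]//|].
  by move/(_ c); rewrite cC eqxx.
exists (fun b => P (f b)); split; first split.
- by move=> b /fP[fC _]; apply: PC.
- move=> b d z /fP[bC eb] /fP[dC ed] zb zd; rewrite -eb -ed.
  by congr en; apply: Pdis zb zd.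
- move=> b /fP[/PC]; rewrite /en; case: (P _) => //= a s _; exact.
Qed.

(** Induction on the number of arcs. If deleting the arc [xy] leaves a separator [S] with fewer than
    [k] vertices, adding [x] or [y] to it separates [A] from [B] in [g]. Paths from [A] to [x |: S]
    and from [y |: S] to [B] are then joined at [S] and along the arc. *)
Lemma menger g A B k :
  (exists2 S, separates g A B S & #|S| < k) \/
  (exists C P, linkage g A B C P /\ k <= #|C|).
Proof.
have [m] := ubnP #|[set u : T * T | g u.1 u.2]|.
elim: m => // m IH in g A B * => lem.
case: (boolP [exists x, exists y, g x y]); last first.
  move=> nog; have g0 x y : g x y = false.
    by apply/negbTE; move: nog; rewrite negb_exists => /forallP/(_ x);
       rewrite negb_exists => /forallP/(_ y).
  (* Without arcs every path is a single vertex, so [A :&: B] is a separator and also indexes a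
     linkage. *)
  case: (ltnP #|A :&: B| k) => ck.
    left; exists (A :&: B) => // a [|b s] aA /=; last by rewrite g0.
    by move=> _ aB; rewrite inE aA aB.
  right; exists (A :&: B), (fun c => [:: c]); split=> //; split=> [c|c d z _ _].
    by rewrite inE => /andP[cA cB]; rewrite /= cA cB.
  by rewrite !inE => /eqP-> /eqP.
move=> /existsP[x /existsP[y gxy]].
pose g' := del_arc g x y.
have card_g' : #|[set u : T * T | g' u.1 u.2]| < m.
  rewrite -ltnS; apply: leq_trans lem; rewrite ltnS; apply: proper_card.
  apply/properP; split.
    by apply/subsetP => u; rewrite !inE => /sub_del_arc.
  by exists (x, y); rewrite !inE //= /g' /del_arc !eqxx andbF.
case: (IH g' A B card_g') => [[S sepS ltS]|[C [P [[PC Pd] kC]]]]; last first.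
  right; exists C, P; split=> //; split=> // c /PC; case: (P c) => //= a s.
  by move=> /and4P[-> ps -> ->]; rewrite (sub_path (@sub_del_arc g x y)).
have sepx := separates_add_source sepS.
have sepS_rev : separates (del_arc (rev_rel g) y x) B A S.
  move=> b s bB ps; apply: (separates_rev sepS) => //.
  by apply: sub_path ps => u v; rewrite /del_arc /rev_rel andbC [_ && (v == x)]andbC andbC.
case: (ltnP #|x |: S| k) => [ltx|lex]; first by left; exists (x |: S).
have sepy : separates g A B (y |: S).
  move=> a s aA gs lB.
  have := separates_rev (separates_add_source sepS_rev).
  by apply=> //; apply: sub_path gs.
case: (ltnP #|y |: S| k) => [lty|ley]; first by left; exists (y |: S).
have xS : x \notin S by apply: contraL lex => xS; rewrite -ltnNge cardsU1 xS.
have yS : y \notin S by apply: contraL ley => yS; rewrite -ltnNge cardsU1 yS.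
case: (IH g' A (x |: S) card_g') => [[S' sS' lt']|[CA [PA0 [lA kA]]]].
  by left; exists S' => //; apply: separates_del_arc sS'.
have card_rev : #|[set u : T * T | rev_rel g' u.1 u.2]| < m.
  apply: leq_ltn_trans card_g'.
  have sw_inj : injective (fun u : T * T => (u.2, u.1)) by move=> [? ?] [? ?] [-> ->].
  rewrite -(card_imset _ sw_inj); apply: subset_leq_card.
  by apply/subsetP => _ /imsetP[u + ->]; rewrite !inE.
case: (IH (rev_rel g') B (y |: S) card_rev) => [[S' sS' lt']|[CB [PB0 [lB kB]]]].
  left; exists S' => //.
  have /(separates_del_arc sepS_rev)/separates_rev sepS'' :
    separates (del_arc (rev_rel g) y x) B (y |: S) S'.
    move=> b s bB ps; apply: sS' => //.
    by apply: sub_path ps => u v; rewrite /g' /del_arc /rev_rel andbC [_ && (v == x)]andbC andbC.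
  by move=> a s aA gs lB; apply: sepS''.
have [PA [[PAp PAd] PAe]] : exists P, linkage g' A (x |: S) (x |: S) P /\
    {in x |: S, forall b, last b (P b) = b}.
  by apply: linkage_reindex lA _; apply: leq_trans kA; rewrite cardsU1 xS.
have [PB [[PBp PBd] PBe]] : exists P, linkage (rev_rel g') B (y |: S) (y |: S) P /\
    {in y |: S, forall b, last b (P b) = b}.
  by apply: linkage_reindex lB _; apply: leq_trans kB; rewrite cardsU1 yS.
have PA_end c : c \in x |: S -> c \in PA c.
  move=> cS; have := PAp c cS; have := PAe c cS.
  by case: (PA c) => //= a s le _; rewrite -{1}le mem_last.
have PB_end c : c \in y |: S -> c \in PB c.
  move=> cS; have := PBp c cS; have := PBe c cS.
  by case: (PB c) => //= a s le _; rewrite -{1}le mem_last.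
(* Otherwise the segments up to z would join A to B in g' while avoiding S. *)
have meet c d z : c \in x |: S -> d \in y |: S -> z \in PA c -> z \in PB d ->
    [/\ z \in S, z = c & z = d].
  move=> cS dS zA zB.
  have := PAp c cS; have := PAe c cS; case EA: (PA c) => [//|a s] /= lac.
  move=> /and4P[aA pas _ uas].
  have := PBp d dS; have := PBe d dS; case EB: (PB d) => [//|b r] /= lbd.
  move=> /and4P[bB pbr _ ubr].
  have := zA; rewrite EA => zas; have := zB; rewrite EB => zbr.
  case/splitPl: zas EA lac pas uas => s1 s2 ls1 EA lac pas uas.
  case/splitPl: zbr EB lbd pbr ubr => r1 r2 lr1 EB lbd pbr ubr.
  move: pas pbr; rewrite !cat_path => /andP[ps1 _] /andP[pr1 _].
  have pz : path g' a (s1 ++ rev (belast b r1)).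
    by rewrite cat_path ps1 ls1 -lr1 rev_path.
  have lz : last a (s1 ++ rev (belast b r1)) \in B.
    by rewrite last_cat ls1 last_rev_belast.
  have /hasP[w ws /= wS] := sepS _ _ aA pz lz.
  have : w \in a :: s1 \/ w \in b :: r1.
    move: ws; rewrite -cat_cons mem_cat => /orP[->|w1]; first by left.
    by right; rewrite -mem_rev_belast inE w1 orbT.
  have wx : w \in x |: S by rewrite setU1r.
  have wy : w \in y |: S by rewrite setU1r.
  case=> ww.
    have wc : w = c.
      by apply: (PAd w c w) => //; [exact: PA_end|rewrite EA -cat_cons mem_cat ww].
    (* [w = c] is the last vertex of [PA c] and already occurs in the part up to [z]; as no vertex
       repeats, nothing follows [z]. *)
    have s20 : s2 = [::].
      case/lastP: s2 lac uas {EA} => // s2 e; rewrite last_cat last_rcons => ec.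
      rewrite -/(uniq (a :: _)) -cat_cons cat_uniq => /and3P[_ /hasPn/(_ e)].
      by rewrite mem_rcons mem_head ec -wc /= ww => /(_ isT).
    have zc : z = c by rewrite -ls1 -lac s20 cats0.
    split=> //; first by rewrite zc -wc.
    by apply: (PBd z d z) => //; rewrite zc -wc // PB_end.
  have wd : w = d.
    by apply: (PBd w d w) => //; [exact: PB_end|rewrite EB -cat_cons mem_cat ww].
  have r20 : r2 = [::].
    case/lastP: r2 lbd ubr {EB} => // r2 e; rewrite last_cat last_rcons => ec.
    rewrite -/(uniq (b :: _)) -cat_cons cat_uniq => /and3P[_ /hasPn/(_ e)].
    by rewrite mem_rcons mem_head ec -wd /= ww => /(_ isT).
  have zd : z = d by rewrite -lr1 -lbd r20 cats0.
  split=> //; first by rewrite zd -wd.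
  by apply: (PAd z c z) => //; rewrite zd -wd // PA_end.
(* The continuation after [c]: from [x] the arc to [y] is taken, so [y] is kept; at a vertex of [S]
   the shared vertex is dropped by [behead]. *)
pose tl c := if c == x then rev (PB y) else behead (rev (PB c)).
have tl_sub c z : c \in x |: S -> z \in tl c ->
    exists d, [/\ d \in y |: S, z \in PB d, (c == x) = (d \notin S) & c != x -> d = c].
  rewrite /tl in_setU1; case: eqP => [_ _|_ /= cS].
    by rewrite mem_rev => zy; exists y; rewrite setU11 yS.
  by move/mem_behead; rewrite mem_rev => zc; exists c; rewrite setU1r // cS.
right; exists (x |: S), (fun c => PA c ++ tl c); split=> //; split.
  move=> c cS; have := PAp c cS; have := PAe c cS; case EA: (PA c) => [//|a s] /= lac.
  move=> /and4P[aA pas _ uas]; rewrite aA /= -/(uniq (a :: _)).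
  rewrite -/(uniq (a :: s)) in uas.
  have utl : uniq (tl c) -> uniq (a :: s ++ tl c).
    rewrite -cat_cons cat_uniq uas => -> /=; rewrite andbT; apply/hasPn => z zt /=.
    have [d [dS zd cd dc]] := tl_sub _ _ cS zt.
    apply/negP=> zA; rewrite -EA in zA.
    have [zS zc zd'] := meet _ _ _ cS dS zA zd.
    move: zt; rewrite /tl; move: cd; rewrite -zd' zS /= => ->.
    have := PBp d dS; have := PBe d dS; rewrite -zc zd'.
    case: (PB d) => //= b r lbr /and4P[_ _ _].
    rewrite -/(uniq (b :: r)) lastI rev_rcons lbr rcons_uniq => /andP[nb _].
    by rewrite /= mem_rev (negbTE nb).
  move: utl; rewrite /tl; case: eqP => [cx|/eqP cx].
    have := PBp y (setU11 _ _); have := PBe y (setU11 _ _); case EB: (PB y) => [//|b r] /= lby.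
    move=> /and4P[bB pbr _ ubr]; rewrite rev_uniq => /(_ ubr) /= ->.
    rewrite last_cat cat_path (sub_path (@sub_del_arc g x y) pas) lac cx.
    rewrite lastI rev_rcons lby /= gxy last_rev_belast // bB -lby rev_path /= andbT.
    by apply: sub_path pbr => u v /sub_del_arc.
  have cSS : c \in S by move: cS; rewrite in_setU1 (negbTE cx).
  have cSy : c \in y |: S by rewrite setU1r.
  have := PBp c cSy; have := PBe c cSy; case EB: (PB c) => [//|b r] /= lbc.
  move=> /and4P[bB pbr _]; rewrite -/(uniq (b :: r)) lastI rev_rcons rcons_uniq => /andP[_ ubr] /=.
  rewrite rev_uniq => /(_ ubr) ->.
  rewrite last_cat cat_path (sub_path (@sub_del_arc g x y) pas) lac.
  rewrite last_rev_belast // bB -lbc rev_path /= andbT.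
  by apply: sub_path pbr => u v /sub_del_arc.
move=> c c' z cS cS'; rewrite !mem_cat => /orP[zc|zc] /orP[zc'|zc'].
- exact: PAd zc zc'.
- have [d [dS zd cd dc]] := tl_sub _ _ cS' zc'.
  have [zS zc0 zd'] := meet _ _ _ cS dS zc zd.
  by rewrite -zc0 zd' dc // cd -zd' zS.
- have [d [dS zd cd dc]] := tl_sub _ _ cS zc.
  have [zS zc0 zd'] := meet _ _ _ cS' dS zc' zd.
  by rewrite -zc0 zd' dc // cd -zd' zS.
- have [d [dS zd cd dc]] := tl_sub _ _ cS zc.
  have [d' [dS' zd' cd' dc']] := tl_sub _ _ cS' zc'.
  have dd := PBd _ _ _ dS dS' zd zd'; subst d'.
  case: (altP (c =P x)) cd dc => [-> /esym dS2 _|cx cd dc].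
    by move: cd'; rewrite dS2 => /eqP.
  by rewrite -dc // dc' // cd' -cd.
Qed.
End Menger.

(** * The colouring given by a spanning k-connected subgraph *)

Section DisjointPaths.
Variable T : finType.
Implicit Types (h : rel T) (S : {set T}) (x y z : T).

(** Menger's theorem is applied between the neighbourhoods of [x] and [y] after both vertices have
    been removed; the paths found are the interiors. *)
Lemma disjoint_paths_nonadjacent h x y j :
  x != y -> ~~ h x y ->
  (forall S, #|S| < j -> x \notin S -> y \notin S ->
     connect [rel u v | [&& h u v, u \notin S & v \notin S]] x y) ->
  exists (C : {set T}) (P : T -> seq T),
  [/\ j <= #|C|,
      {in C, forall c, path h x (rcons (P c) y) && uniq (x :: rcons (P c) y)},
      {in C, forall c, P c != [::]} &
      forall c d z, c \in C -> d \in C -> z \in P c -> z \in P d -> c = d].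
Proof.
move=> nxy nhxy conn; pose X := [set x; y].
pose g : rel T := [rel u v | [&& h u v, u \notin X & v \notin X]].
pose A := [set u | h x u & u \notin X]; pose B := [set u | h u y & u \notin X].
case: (menger g A B j) => [[S sepS ltS]|[C [P [[PC Pd] jC]]]]; last first.
  have PE c : c \in C -> exists a s, [/\ P c = a :: s, h x a, path h a s, h (last a s) y &
      uniq (a :: s) && all (fun u => u \notin X) (a :: s)].
    move=> /PC; case: (P c) => // a s /and4P[+ pas + us]; rewrite [a \in _]inE [_ \in B]inE.
    move=> /andP[hxa aX] /andP[hy _]; exists a, s; split=> //.
      by apply: sub_path pas => u v /and3P[].
    rewrite us /= aX /=; elim: s a pas {hxa hy aX us} => //= b s IH a /andP[/and3P[_ _ ->]].
    exact: IH.
  exists C, P; split=> // c /PE[a [s [-> hxa pas hy /andP[us /allP aX]]]] //.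
  rewrite /= hxa rcons_path pas hy /= -/(uniq (a :: s)) -!rcons_cons mem_rcons.
  rewrite -[_ && uniq (rcons s y)]/(uniq (rcons (a :: s) y)) rcons_uniq us andbT inE negb_or nxy /=.
  by apply/andP; split; apply/negP => /aX; rewrite !inE eqxx ?orbT.
(* The separator may contain [x] or [y], which the connectivity hypothesis excludes; dropping them
   loses nothing, since interiors avoid both. *)
exfalso; have ltS' : #|S :\: X| < j by apply: leq_ltn_trans ltS; rewrite subset_leq_card ?subsetDl.
have /connectP[s ps] : connect [rel u v | [&& h u v, u \notin S :\: X & v \notin S :\: X]] x y.
  by apply: conn ltS' _ _; rewrite !inE eqxx ?orbT.
case/shortenP: ps => {}s ps us _; case/lastP: s ps us => [|s b].
  by move=> _ _ /= E; rewrite E eqxx in nxy.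
rewrite last_rcons => ps us yb; subst b.
case: s ps us => [|a s]; first by rewrite /= (negbTE nhxy).
rewrite rcons_cons => /= /andP[/and3P[hxa _ aS]]; rewrite rcons_path => /andP[pas /and3P[hly _ _]].
rewrite -/(uniq (a :: rcons s y)) -rcons_cons mem_rcons rcons_uniq inE negb_or.
move=> /and3P[/andP[_ xs] ys us].
have allX : all (fun u => u \notin X) (a :: s).
  apply/allP => u us'; rewrite !inE negb_or; apply/andP; split.
    by apply: contraNneq xs => <-.
  by apply: contraNneq ys => <-.
have pg : path g a s.
  apply: sub_in_path allX pas => u v uX vX /= /and3P[huv _ _].
  by rewrite /g /= huv /=; apply/andP.
have /hasP[w ws /= wS] : has (mem S) (a :: s).
  apply: sepS => //; rewrite inE ?hxa ?hly; apply: (allP allX) => //; first exact: mem_head.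
  exact: mem_last.
have : all (fun u => u \notin S :\: X) (a :: s).
  rewrite /= aS /=; elim: s a pas {hxa aS hly xs ys us allX pg ws} => //= b s IH a.
  move=> /andP[/and3P[_ _ ->]].
  exact: IH.
by move=> /allP/(_ _ ws); rewrite inE wS (allP allX).
Qed.

(** If [xy] is an edge, it is one of the paths, with empty interior, and the other [k - 1] come from
    the graph without this edge. *)
Lemma k_connected_paths h k x y :
  symmetric h -> k_connected k h -> x != y ->
  exists Q : 'I_k -> seq T,
  [/\ injective Q,
      forall i, path h x (rcons (Q i) y) && uniq (x :: rcons (Q i) y) &
      forall i j, i != j -> forall v, v \in Q i -> v \notin Q j].
Proof.
move=> hsym [ltk kc] nxy.
have fam (C : {set T}) (i : nat) : i < #|C| -> nth x (enum C) i \in C.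
  by move=> ic; rewrite -mem_enum mem_nth // -cardE.
have nthI (C : {set T}) (i j : nat) : i < #|C| -> j < #|C| ->
    nth x (enum C) i = nth x (enum C) j -> i = j.
  by move=> ic jc /eqP; rewrite nth_uniq -?cardE ?enum_uniq // => /eqP.
case: (boolP (h x y)) => hxy; last first.
  have [S ltS xS yS|C [P [kC PC P0 Pd]]] := @disjoint_paths_nonadjacent h x y k nxy hxy.
    exact: kc.
  have iC (i : 'I_k) : i < #|C| by apply: leq_trans kC.
  exists (fun i : 'I_k => P (nth x (enum C) i)); split.
  - move=> i j E; apply: val_inj; apply: (nthI C _ _ (iC i) (iC j)).
    have := P0 _ (fam C i (iC i)); case EP: (P _) => [//|a s] _.
    apply: (Pd _ _ a); rewrite ?fam //; first by rewrite EP mem_head.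
    by rewrite -E EP mem_head.
  - by move=> i; apply/PC/fam.
  - move=> i j ij v vi; apply: contraNN ij => vj; apply/eqP/val_inj/(nthI C _ _ (iC i) (iC j)).
    by apply: Pd vi vj; rewrite fam.
case: k ltk kc => [|k] ltk kc; first by exists (fun=> [::]); split=> [[]|[]|[]].
pose h' : rel T := [rel u v | h u v && ~~ ([set u; v] == [set x; y])].
have h'1 u v : h u v -> y != u -> y != v -> h' u v.
  move=> huv /negbTE yu /negbTE yv; rewrite /h' /= huv; apply/negP => /eqP/setP/(_ y).
  by rewrite !inE yu yv eqxx orbT.
have h'2 u v : h u v -> x != u -> x != v -> h' u v.
  move=> huv /negbTE yu /negbTE yv; rewrite /h' /= huv; apply/negP => /eqP/setP/(_ x).
  by rewrite !inE yu yv eqxx.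
have nh'xy : ~~ h' x y by rewrite /h' /= eqxx andbF.
have [S ltS xS yS|C [P [kC PC P0 Pd]]] := @disjoint_paths_nonadjacent h' x y k nxy nh'xy.
  (* A third vertex [z] splits the connection: from [x] to [z] the vertex [y] is deleted as well,
     from [z] to [y] the vertex [x], so neither half uses the edge [xy]. *)
  have [z zN] : exists z, z \notin [set x; y] :|: S.
    apply/existsP; rewrite -negb_forall; apply/negP => /forallP full.
    have : #|T| <= 2 + #|S|.
      rewrite -cardsT; have -> : 2 = #|[set x; y]| by rewrite cards2 nxy.
      have [le _] := leq_card_setU [set x; y] S; apply: leq_trans le.
      by rewrite subset_leq_card //; apply/subsetP => u _.
    by move: ltk ltS; lia.
  move: zN; rewrite !inE !negb_or -andbA => /and3P[zx zy zS].
  apply: (@connect_trans _ _ z).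
    have /kc : #|y |: S| < k.+1 by rewrite cardsU1 yS.
    move=> /(_ x z); rewrite !inE !negb_or nxy zy xS zS => /(_ isT isT).
    apply: connect_sub => u v /= /and3P[huv]; rewrite !inE !negb_or => /andP[uy uS] /andP[vy vS].
    by apply: connect1; rewrite /= uS vS h'1 // eq_sym.
  have /kc : #|x |: S| < k.+1 by rewrite cardsU1 xS.
  move=> /(_ z y); rewrite !inE !negb_or [y == x]eq_sym nxy zx yS zS => /(_ isT isT).
  apply: connect_sub => u v /= /and3P[huv]; rewrite !inE !negb_or => /andP[uy uS] /andP[vy vS].
  by apply: connect1; rewrite /= uS vS h'2 // eq_sym.
have iC (i : 'I_k.+1) : i != ord0 -> i.-1 < #|C|.
  by rewrite -val_eqE /= => i0; have := ltn_ord i; lia.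
have pI (i j : 'I_k.+1) : i != ord0 -> j != ord0 -> i.-1 = j.-1 -> i = j.
  by rewrite -!val_eqE /= => i0 j0 E; apply: val_inj; move: i0 j0 E; rewrite /=; lia.
exists (fun i : 'I_k.+1 => if i == ord0 then [::] else P (nth x (enum C) i.-1)); split.
- move=> i j; case: (altP (i =P ord0)) => [->|i0]; case: (altP (j =P ord0)) => [->|j0] //.
  + by move=> E; have := P0 _ (fam C _ (iC _ j0)); rewrite -E.
  + by move=> E; have := P0 _ (fam C _ (iC _ i0)); rewrite E.
  move=> E; apply: pI => //; apply: (nthI C _ _ (iC _ i0) (iC _ j0)).
  have := P0 _ (fam C _ (iC _ i0)); case EP: (P _) => [//|a s] _.
  apply: (Pd _ _ a); rewrite ?fam ?iC //; first by rewrite EP mem_head.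
  by rewrite -E EP mem_head.
- move=> i; case: ifP => [_|/negbT i0]; first by rewrite /= hxy inE nxy.
  have /andP[pp ->] := PC _ (fam C _ (iC _ i0)); rewrite andbT.
  by apply: sub_path pp => u v /andP[].
- move=> i j; case: ifP => [//|/negbT i0]; case: ifP => [//|/negbT j0].
  move=> ij v vi; apply: contraNN ij => vj; apply/eqP/pI => //.
  apply: (nthI C _ _ (iC _ i0) (iC _ j0)).
  by apply: Pd vi vj; rewrite fam ?iC.
Qed.
End DisjointPaths.

Section SpanningColouring.
Variables (T : finType) (e h : rel T).

(** The successor keeps the private colours of the remaining edges different from 0. *)
Definition spanning_colouring : colouring T :=
  fun A => if A \in edges h then 0 else (index A (enum (edges e))).+1.

Lemma mem_edges (g : rel T) u v : g u v -> [set u; v] \in edges g.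
Proof.
by move=> guv; rewrite inE; apply/existsP; exists u; apply/existsP; exists v; rewrite eqxx.
Qed.

Lemma edges_sub : subrel h e -> edges h \subset edges e.
Proof.
move=> he; apply/subsetP => A; rewrite !inE => /existsP[u /existsP[v /andP[/eqP-> /he euv]]].
by apply/existsP; exists u; apply/existsP; exists v; rewrite eqxx.
Qed.

Lemma ncolours_spanning_colouring : subrel h e -> 0 < nedges h ->
  ncolours e spanning_colouring = nedges e - nedges h + 1.
Proof.
move=> he h0; pose col A := (index A (enum (edges e))).+1.
pose s := 0 :: [seq col A | A <- enum (edges e :\: edges h)].
have us : uniq s.
  rewrite /= map_inj_in_uniq ?enum_uniq ?andbT; first by apply/mapP => -[].
  move=> A B; rewrite !mem_enum !in_setD => /andP[_ Ae] /andP[_ Be] [].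
  move=> /(congr1 (nth A (enum (edges e)))).
  by rewrite !nth_index ?mem_enum.
rewrite /ncolours; have -> : size (undup [seq spanning_colouring A | A <- enum (edges e)]) = size s.
  rewrite -(undup_id us); apply/perm_size/perm_undup => i; apply/mapP/idP.
    move=> [A]; rewrite mem_enum /spanning_colouring => Ae ->.
    case: ifP => [_|Ah]; first exact: mem_head.
    by rewrite inE orbC map_f // mem_enum in_setD Ah.
  rewrite inE => /orP[/eqP->|/mapP[A]].
    have /card_gt0P[A Ah] := h0; exists A; rewrite /spanning_colouring ?Ah // mem_enum.
    exact: (subsetP (edges_sub he)).
  rewrite mem_enum in_setD => /andP[/negbTE Ah Ae] ->.
  by exists A; rewrite /spanning_colouring ?Ah // mem_enum.
by rewrite /= size_map -cardE cardsD (setIidPr (edges_sub he)) addn1.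
Qed.

Lemma mono_k_connected_spanning_colouring k :
  symmetric h -> subrel h e -> k_connected k h ->
  mono_k_connected k e spanning_colouring.
Proof.
move=> hsym he kc x y nxy; have [Q [Qi Qp Qd]] := k_connected_paths hsym kc nxy.
exists Q; split=> //; split=> // i; exists 0; have /andP[pp ->] := Qp i; rewrite andbT.
by apply: sub_path pp => u v /= huv; rewrite /colour_rel /= he //= /spanning_colouring mem_edges.
Qed.
End SpanningColouring.

(** * Counting edges of connected graphs *)

Section GraphCounting.
Variable T : finType.
Implicit Types (g : rel T) (S V : {set T}) (u v w x y : T).

Lemma sum_mem (A : {set T}) : \sum_u (u \in A : nat) = #|A|.
Proof. by rewrite -sum1_card [RHS]big_mkcond; apply: eq_bigr => u _; case: (_ \in _). Qed.

Definition deg g u : nat := #|[set w | g u w]|.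

Definition support g : {set T} := [set u | 0 < deg g u].

Lemma edgesP g A :
  reflect (exists u v, A = [set u; v] /\ g u v) (A \in edges g).
Proof.
rewrite inE; apply: (iffP existsP) => [[u /existsP[v /andP[/eqP-> guv]]]|[u [v [-> guv]]]].
  by exists u, v.
by exists u; apply/existsP; exists v; rewrite eqxx.
Qed.

Lemma handshake g : symmetric g -> irreflexive g ->
  \sum_u deg g u = (nedges g).*2.
Proof.
move=> gs gi; have -> : \sum_u deg g u = \sum_(p : T * T | g p.1 p.2) 1.
  rewrite -(pair_big_dep xpredT (fun u v => g u v) (fun _ _ => 1)) /=.
  by apply: eq_bigr => u _; rewrite sum1_card /deg cardsE.
rewrite (partition_big (fun p : T * T => [set p.1; p.2]) (mem (edges g))) /=; last first.
  by move=> p gp; apply: mem_edges.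
rewrite (eq_bigr (fun=> 2)) ?sum_nat_const ?muln2 // => A /edgesP[x [y [-> gxy]]].
have nxy : x != y by apply: contraTneq gxy => ->; rewrite gi.
rewrite (bigD1 (x, y)) /= ?gxy ?eqxx // (bigD1 (y, x)) /=; last first.
  by rewrite gs gxy setUC eqxx /= xpair_eqE eq_sym (negbTE nxy).
rewrite big1 ?addn0 // => -[u v] /= /andP[/andP[/andP[guv /eqP E] n1] n2].
have nuv : u != v by apply: contraTneq guv => ->; rewrite gi.
have: u \in [set x; y] by rewrite -E set21.
have: v \in [set x; y] by rewrite -E set22.
move: n1 n2 nuv; rewrite !xpair_eqE !inE => n1 n2 nuv /orP[]/eqP Ev /orP[]/eqP Eu.
all: by move: n1 n2 nuv; rewrite Ev Eu !eqxx.
Qed.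

Lemma path_crossing g S x s : path g x s -> x \in S -> last x s \notin S ->
  exists u v, [/\ g u v, u \in S, v \notin S & v \in s].
Proof.
elim: s x => [|z s IH] x /=; first by move=> _ ->.
move=> /andP[gxz ps] xS lS; case: (boolP (z \in S)) => zS.
  by have [u [v [? ? ? vs]]] := IH z ps zS lS; exists u, v; rewrite inE vs orbT.
by exists x, z; rewrite mem_head.
Qed.

Lemma connect_crossing g S x y : connect g x y -> x \in S -> y \notin S ->
  exists u v, [/\ g u v, u \in S & v \notin S].
Proof.
move=> /connectP[s ps ->] xS lS.
by have [u [v [? ? ? _]]] := path_crossing ps xS lS; exists u, v.
Qed.

(** The predecessor and the successor of [z] on the path are distinct neighbours, so degree at most
    2 leaves no other. *)
Lemma path_interior_nbr g x y s z w :
  symmetric g -> path g x (rcons s y) -> uniq (x :: rcons s y) -> z \in s ->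
  deg g z <= 2 -> g z w -> w \in x :: rcons s y.
Proof.
move=> gs ps us zs; case/splitPr: zs ps us => s1 s2; rewrite rcons_cat rcons_cons.
rewrite -cat_cons cat_uniq cat_path => /andP[_ pz] /and3P[_ /hasPn dis _] dz gzw.
move: pz => /= /andP[gpz pz].
have gzn : g z (head y s2) by move: pz; case: (s2) => [|b r] /= /andP[].
have ns : head y s2 \in z :: rcons s2 y.
  by rewrite inE orbC; case: (s2) => [|b r]; rewrite /= !inE eqxx.
have pn : last x s1 != head y s2.
  by apply: contraTneq (mem_last x s1) => ->; apply: dis.
have sub : [set last x s1; head y s2] \subset [set u | g z u].
  by apply/subsetP => u; rewrite !inE => /orP[/eqP->|/eqP->]; rewrite // gs.
have E : [set last x s1; head y s2] = [set u | g z u].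
  by apply/eqP; rewrite eqEcard sub cards2 pn.
have : w \in [set last x s1; head y s2] by rewrite E inE.
rewrite !inE => /orP[/eqP->|/eqP->].
  by rewrite mem_cat orbA -[_ || (_ \in s1)]/(_ \in x :: s1) mem_last.
by rewrite mem_cat ns !orbT.
Qed.

(** A set grows from one vertex along crossing edges: each step adds one vertex and at least one
    edge inside the set, [wi S] being the edges inside [S]. *)
Lemma connected_card g V :
  {in V &, forall u v, connect g u v} -> #|V| <= (nedges g).+1.
Proof.
move=> conn; case: (set_0Vmem V) => [->|[r rV]]; first by rewrite cards0.
pose wi S := [set A in edges g | A \subset S].
suff grow m S : #|~: S| <= m -> r \in S -> #|S| <= #|wi S|.+1 -> #|V| <= (nedges g).+1.
  by apply: (grow _ [set r] (leqnn _)); rewrite ?set11 // cards1.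
elim: m S => [|m IH] S leS rS cS.
  all: have [VS|/subsetPn[v vV vS]] := boolP (V \subset S).
  1,3: by apply: leq_trans (subset_leq_card VS) (leq_trans cS _); rewrite ltnS;
     apply/subset_leq_card/subsetP => A; rewrite inE => /andP[].
  by move: leS; rewrite leqn0 cards_eq0 => /eqP/setP/(_ v); rewrite !inE vS.
have [u [w [guw uS wS]]] := connect_crossing (conn _ _ rV vV) rS vS.
apply: (IH (w |: S)).
- rewrite -ltnS; apply: leq_trans leS; apply: proper_card; apply/properP; split.
    by apply/subsetP => z; rewrite !inE negb_or => /andP[].
  by exists w; rewrite !inE ?eqxx.
- by rewrite setU1r.
rewrite cardsU1 wS add1n ltnS; apply: leq_trans cS _.
apply: proper_card; apply/properP; split.
  apply/subsetP => A; rewrite !inE => /andP[-> AS] /=.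
  by apply: subset_trans AS _; apply: subsetUr.
exists [set u; w].
  rewrite inE mem_edges //=; apply/subsetP => z; rewrite !inE.
  by move=> /orP[/eqP->|/eqP->]; rewrite ?eqxx ?uS ?orbT.
rewrite inE mem_edges //=; apply/subsetPn; exists w => //; exact: set22.
Qed.

(* Two disjoint paths close up to a cycle, so an edge can be deleted without disconnecting V. *)
Lemma connected_card_cycle g V x y (s1 s2 : seq T) :
  symmetric g -> {in V &, forall u v, connect g u v} ->
  path g x (rcons s1 y) -> uniq (x :: rcons s1 y) ->
  path g x (rcons s2 y) -> uniq (x :: rcons s2 y) ->
  s1 != [::] -> (forall v, v \in s1 -> v \notin s2) -> #|V| <= nedges g.
Proof.
move=> gs conn; case: s1 => // a s1; rewrite rcons_cons.
move=> /= /andP[gxa p1] /and3P[x1 a1 _] p2 /andP[x2 _] _ dis.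
pose g' : rel T := [rel u v | g u v && ([set u; v] != [set x; a])].
have g's : symmetric g' by move=> u v; rewrite /g' /= gs setUC.
have xy : x != y by apply: contraNneq x2 => ->; rewrite mem_rcons mem_head.
have xa : x != a by apply: contraNneq x1 => ->; rewrite mem_head.
have ng' u v : g u v -> (x != u) && (x != v) || (a != u) && (a != v) -> g' u v.
  move=> guv h; rewrite /g' /= guv /=; apply/negP => /eqP/setP E.
  have := E x; have := E a; rewrite !inE !eqxx ?orbT.
  by move: h; case: (x == u); case: (x == v); case: (a == u); case: (a == v).
have cxy : connect g' x y.
  apply/connectP; exists (rcons s2 y); rewrite ?last_rcons //.
  have al : all (fun z => a != z) (x :: rcons s2 y).
    rewrite /= eq_sym xa /=; apply/allP => z; rewrite mem_rcons inE => /orP[/eqP->|z2].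
      by apply: contraNneq a1 => ->; rewrite mem_rcons mem_head.
    by apply: contraTneq z2 => <-; apply: dis; rewrite mem_head.
  apply: sub_in_path al p2 => u v ua va guv; apply: ng' => //.
  by apply/orP; right; apply/andP.
have cay : connect g' a y.
  apply/connectP; exists (rcons s1 y); rewrite ?last_rcons //.
  have al : all (fun z => x != z) (a :: rcons s1 y).
    by apply/allP => z zs; apply: contraNneq x1 => ->.
  apply: sub_in_path al p1 => u v ua va guv; apply: ng' => //.
  by apply/orP; left; apply/andP.
have csym := sym_connect_sym g's.
have cxa : connect g' x a by apply: connect_trans cxy _; rewrite csym.
have conn' : {in V &, forall u v, connect g' u v}.
  move=> u0 v0 uV vV; apply: connect_sub (conn _ _ uV vV) => u v guv.
  case: (altP ([set u; v] =P [set x; a])) => [E|E]; last by apply: connect1; rewrite /g' /= guv.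
  have: u \in [set x; a] by rewrite -E set21.
  have: v \in [set x; a] by rewrite -E set22.
  by rewrite !inE => /orP[]/eqP-> /orP[]/eqP->; rewrite ?connect0 // csym.
apply: leq_trans (connected_card conn') _; apply: proper_card; apply/properP; split.
  by apply/subsetP => A /edgesP[u [v [-> /andP[guv _]]]]; apply: mem_edges.
exists [set x; a]; first exact: mem_edges.
by apply/edgesP => -[u [v [E /andP[_]]]]; rewrite E eqxx.
Qed.

Lemma deg_support g u : symmetric g -> irreflexive g -> 0 < deg g u ->
  deg g u < #|support g|.
Proof.
move=> gs gi du; apply: proper_card; apply/properP; split.
  apply/subsetP => w; rewrite !inE => guw.
  by apply/card_gt0P; exists u; rewrite inE gs.
by exists u; rewrite inE ?gi.
Qed.

(** Degrees stay below the size of the support, so a support of two vertices carries at most one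
    edge. *)
Lemma support_card g : symmetric g -> irreflexive g -> 2 <= nedges g ->
  3 <= #|support g|.
Proof.
move=> gs gi e2; have hs := handshake gs gi.
have le u : deg g u <= (u \in support g) * #|support g|.-1.
  rewrite inE; case: posnP => [->//|du]; rewrite mul1n; have := deg_support gs gi du.
  by case: #|_|.
have : (nedges g).*2 <= #|support g| * #|support g|.-1.
  rewrite -hs -[X in _ <= X * _]sum_mem big_distrl /=.
  by apply: leq_sum => u _; apply: le.
by case: #|_| => [|[|[|//]]] /=; lia.
Qed.
End GraphCounting.

(** * Families of edge-disjoint connected classes *)

Section ColourClasses.
Variables (T I : finType) (F : I -> rel T) (k : nat).

(* [col a] is the nontrivial colour class that carries the path with interior
   [Q a]; [None] stands for the single edge [xy] when it lies in no class. *)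
Definition path_system x y (Q : 'I_k -> seq T) (col : 'I_k -> option I) : Prop :=
  [/\ injective Q /\ (forall a b, a != b -> forall v, v \in Q a -> v \notin Q b),
      forall a, uniq (x :: rcons (Q a) y),
      forall a i, col a = Some i -> path (F i) x (rcons (Q a) y) &
      forall a, col a = None -> Q a = [::] /\ forall i, ~~ F i x y].

Hypothesis Fsym : forall i, symmetric (F i).
Hypothesis Firr : forall i, irreflexive (F i).
Hypothesis Fdisj : forall i j x y, F i x y -> F j x y -> i = j.
Hypothesis Fconn : forall i, {in support (F i) &, forall x y, connect (F i) x y}.
Hypothesis Fedges : forall i, 2 <= nedges (F i).
Hypothesis Fpaths : forall x y, x != y -> exists Q col, path_system x y Q col.
Hypothesis k_ge2 : 2 <= k.
Hypothesis k_le5 : k <= 5.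
Hypothesis k_ltn : k < #|T|.

Local Notation n := #|T|.
Local Notation d i u := (deg (F i) u).
Local Notation m i := (nedges (F i)).
Local Notation V i := (support (F i)).

Definition adj u v := [exists i, F i u v].
Definition total_deg u := \sum_i d i u.
Local Notation D := total_deg.
Definition cnt (col : 'I_k -> option I) i := #|[set a | col a == Some i]|.

(* Bounds the number of disjoint paths from u to v inside class i: a class with
   fewer edges than vertices is a tree and carries at most one. *)
Definition path_cap i u v :=
  if m i < #|V i| then (0 < d i u) && (0 < d i v) : nat else minn (d i u) (d i v).

Local Notation q := path_cap.

Lemma sum_cnt col : \sum_i cnt col i + #|[set a | col a == None]| = k.
Proof.
have -> : \sum_i cnt col i = \sum_i \sum_a (col a == Some i : nat).
  by apply: eq_bigr => i _; rewrite /cnt -sum_mem; apply: eq_bigr => a _; rewrite inE.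
rewrite exchange_big -sum_mem -big_split /= -[RHS]card_ord -sum1_card.
apply: eq_bigr => a _; rewrite inE; case: (col a) => [j|].
  rewrite (bigD1 j) //= eqxx big1 // => i ij.
  by rewrite (inj_eq Some_inj) eq_sym (negbTE ij).
by rewrite big1.
Qed.

Lemma degP i u : reflect (exists v, F i u v) (0 < d i u).
Proof. by rewrite /deg; apply: (iffP card_gt0P) => -[v uv]; exists v; rewrite inE in uv *. Qed.

Lemma in_support i u : (u \in V i) = (0 < d i u).
Proof. by rewrite inE. Qed.

(** * How many paths of a system fit into one class *)

Section PathSystem.
Variables (x y : T) (Q : 'I_k -> seq T) (col : 'I_k -> option I).
Hypothesis PS : path_system x y Q col.

(** Disjoint paths leave [x] along different edges. The default [y] is the right value for the path
    that is the edge [xy] itself, and injectivity of [Q] allows only one such path. *)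
Lemma head_inj : injective (fun a => head y (Q a)).
Proof.
have [[Qi Qd] Qu _ _] := PS.
have hE a : (Q a = [::] /\ head y (Q a) = y) \/ (head y (Q a) \in Q a /\ head y (Q a) != y).
  have := Qu a; case: (Q a) => [|b s] /=; first by left.
  rewrite mem_head => /and3P[_ + _]; rewrite mem_rcons inE negb_or => /andP[by_ _].
  by right.
move=> a b E; case: (hE a) => -[a1 a2]; case: (hE b) => -[b1 b2].
- by apply: Qi; rewrite a1 b1.
- by rewrite -E a2 eqxx in b2.
- by rewrite E b2 eqxx in a2.
- by apply/eqP/contraT => /Qd/(_ _ a1); rewrite E b1.
Qed.

Lemma last_inj : injective (fun a => last x (Q a)).
Proof.
have [[Qi Qd] Qu _ _] := PS.
have lE a : (Q a = [::] /\ last x (Q a) = x) \/ (last x (Q a) \in Q a /\ last x (Q a) != x).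
  have := Qu a; case/lastP: (Q a) => [|s b] /=; first by left.
  move=> /andP[xs _]; right; rewrite last_rcons mem_rcons mem_head; split=> //.
  by apply: contraNneq xs => ->; rewrite !(mem_rcons, inE) eqxx orbT.
move=> a b E; case: (lE a) => -[a1 a2]; case: (lE b) => -[b1 b2].
- by apply: Qi; rewrite a1 b1.
- by rewrite -E a2 eqxx in b2.
- by rewrite E b2 eqxx in a2.
- by apply/eqP/contraT => /Qd/(_ _ a1); rewrite E b1.
Qed.

Lemma heads_sub i :
  [set head y (Q a) | a in [set a | col a == Some i]] \subset [set w | F i x w].
Proof.
have [_ _ Qp _] := PS; apply/subsetP => _ /imsetP[a + ->].
rewrite !inE => /eqP/Qp; case: (Q a) => [|b s] /=; first by rewrite andbT.
by case/andP.
Qed.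

Lemma lasts_sub i :
  [set last x (Q a) | a in [set a | col a == Some i]] \subset [set w | F i y w].
Proof.
have [_ _ Qp _] := PS; apply/subsetP => _ /imsetP[a + ->].
by rewrite !inE => /eqP/Qp; rewrite rcons_path Fsym => /andP[].
Qed.

Lemma cnt_le_l i : cnt col i <= d i x.
Proof. by rewrite /cnt -(card_imset _ head_inj) subset_leq_card ?heads_sub. Qed.

Lemma cnt_le_r i : cnt col i <= d i y.
Proof. by rewrite /cnt -(card_imset _ last_inj) subset_leq_card ?lasts_sub. Qed.

Lemma head_surj i w : d i x <= cnt col i -> F i x w ->
  exists2 a, col a = Some i & w = head y (Q a).
Proof.
move=> le xw; suff : w \in [set head y (Q a) | a in [set a | col a == Some i]].
  by move=> /imsetP[a + ->]; rewrite inE => /eqP; exists a.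
suff -> : [set head y (Q a) | a in [set a | col a == Some i]] = [set w | F i x w] by rewrite inE.
by apply/eqP; rewrite eqEcard heads_sub (card_imset _ head_inj).
Qed.

Lemma last_surj i w : d i y <= cnt col i -> F i y w ->
  exists2 a, col a = Some i & w = last x (Q a).
Proof.
move=> le xw; suff : w \in [set last x (Q a) | a in [set a | col a == Some i]].
  by move=> /imsetP[a + ->]; rewrite inE => /eqP; exists a.
suff -> : [set last x (Q a) | a in [set a | col a == Some i]] = [set w | F i y w] by rewrite inE.
by apply/eqP; rewrite eqEcard lasts_sub (card_imset _ last_inj).
Qed.

Lemma cnt_none : #|[set a | col a == None]| <= 1.
Proof.
have [[Qi Qd] Qu Qp Qn] := PS.
rewrite leqNgt; apply/card_gt1P => -[a [b [+ + /eqP]]]; rewrite !inE => /eqP/Qn[a0 _] /eqP/Qn[b0 _].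
by apply; apply: Qi; rewrite a0 b0.
Qed.

Lemma cnt_none_adj : adj x y -> #|[set a | col a == None]| = 0.
Proof.
have [_ _ _ Qn] := PS.
move=> /existsP[i xy]; apply/eqP; rewrite cards_eq0; apply/eqP/setP => a; rewrite !inE.
by apply/eqP => /Qn[_ /(_ i)]; rewrite xy.
Qed.

(** Two paths of the system in one class close up to a cycle, which a tree does not contain. At most
    one interior is empty, so the [wlog] can choose a path with nonempty interior. *)
Lemma cnt_q i : cnt col i <= q i x y.
Proof.
have [[Qi Qd] Qu Qp Qn] := PS.
rewrite /path_cap; case: ifP => [tree|_]; last by rewrite leq_min cnt_le_l cnt_le_r.
case: (posnP (cnt col i)) => [->//|c0].
rewrite (leq_trans c0 (cnt_le_l i)) (leq_trans c0 (cnt_le_r i)) /=.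
rewrite leqNgt; apply: contraL tree => /card_gt1P[a [b [+ + ab]]].
rewrite !inE => /eqP ca /eqP cb; rewrite -leqNgt.
wlog a0 : a b ab ca cb / Q a != [::].
  case: (boolP (Q a == [::])) => [/eqP a0|a0] W; last exact: W ab ca cb a0.
  apply: (W b a) => //; first by rewrite eq_sym.
  by apply: contraNneq ab => b0; apply/eqP/Qi; rewrite a0 b0.
apply: (@connected_card_cycle _ (F i) (V i) x y (Q a) (Q b)) => //.
all: by [apply: Qp|apply: Qd].
Qed.
End PathSystem.

Lemma q_le_l i u v : q i u v <= d i u.
Proof.
by rewrite /path_cap; case: ifP => _; [case: (d i u) => //; case: (d i v)|apply: geq_minl].
Qed.

Lemma q_le_r i u v : q i u v <= d i v.
Proof.
by rewrite /path_cap; case: ifP => _; [case: (d i v) => [|?]; case: (d i u)|apply: geq_minr].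
Qed.

(** The only path outside all classes is the edge [xy]; it occurs at most once, and never when
    [adj x y]. *)
Lemma supp x y : x != y -> k + adj x y <= (\sum_i q i x y).+1.
Proof.
move=> /Fpaths[Q [col PS]].
have le : \sum_i cnt col i <= \sum_i q i x y by apply: leq_sum => i _; apply: cnt_q PS i.
have := sum_cnt col; have := cnt_none PS; case: (boolP (adj x y)) => [/(cnt_none_adj PS)|_]; lia.
Qed.

Lemma adj_neq x y : adj x y -> x != y.
Proof. by move=> /existsP[i]; apply: contraTneq => ->; rewrite Firr. Qed.

Lemma supp_adj x y : adj x y -> k <= \sum_i q i x y.
Proof. by move=> xy; have := supp (adj_neq xy); rewrite xy addn1. Qed.

Lemma adj_sum x y : adj x y = \sum_i (F i x y : nat) :> nat.
Proof.
case: (boolP (adj x y)) => [/existsP[i xy]|]; last first.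
  by rewrite negb_exists => /forallP nF; rewrite big1 // => i _; rewrite (negbTE (nF i)).
rewrite (bigD1 i) //= xy big1 // => j ji; apply/eqP; rewrite eqb0; apply: contra ji => xyj.
by rewrite (Fdisj xyj xy).
Qed.

Lemma card_adj x : #|[set y | adj x y]| = D x.
Proof.
rewrite -sum_mem; under eq_bigr => y _ do rewrite inE adj_sum.
rewrite exchange_big; apply: eq_bigr => i _; rewrite /deg -sum_mem.
by apply: eq_bigr => y _; rewrite inE.
Qed.

(** As [k >= 2], some path to another vertex runs in a class and gives [u] a neighbour there; the
    [k] paths to this neighbour all run in classes. *)
Lemma D_ge u : k <= D u.
Proof.
have [v nuv] : exists v, u != v.
  apply/existsP; rewrite -negb_forall; apply/negP => /forallP all_u.
  have : #|T| <= 1.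
    rewrite -(cards1 u) -cardsT subset_leq_card //; apply/subsetP => w _.
    by rewrite inE eq_sym.
  by move: k_ltn k_ge2; lia.
have : 0 < \sum_i q i u v by have := supp nuv; move: k_ge2; lia.
rewrite lt0n sum_nat_eq0 negb_forall => /existsP[i]; rewrite implyTb -lt0n => qi.
have /degP[w uw] := leq_trans qi (q_le_l i u v).
have uwa : adj u w by apply/existsP; exists i.
by apply: leq_trans (supp_adj uwa) _; apply: leq_sum => j _; apply: q_le_l.
Qed.

Lemma V_ge3 i : 3 <= #|V i|.
Proof. exact: support_card. Qed.

Lemma V_le i : #|V i| <= (m i).+1.
Proof. exact: connected_card. Qed.

Lemma sum_deg i : \sum_u d i u = (m i).*2.
Proof. exact: handshake. Qed.

Lemma sum_D : \sum_u D u = (\sum_i m i).*2.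
Proof.
rewrite exchange_big -muln2 big_distrl /=; apply: eq_bigr => i _.
by rewrite muln2 sum_deg.
Qed.

Lemma V_len i : #|V i| <= n.
Proof. exact: max_card. Qed.

Lemma D_ltn u : D u < n.
Proof.
rewrite -card_adj -cardsT; apply: proper_card; apply/properP; split; first exact: subsetT.
by exists u; rewrite ?inE //; apply/negP => /adj_neq; rewrite eqxx.
Qed.

(** * Double counting when no vertex is tight *)

Lemma sum_q i u (c : nat) : (forall v, q i u v <= (v \in V i) * ((u \in V i) * c)) ->
  \sum_(v | v != u) q i u v <= (u \in V i) * c * #|V i|.-1.
Proof.
move=> le; apply: (@leq_trans (\sum_(v | v != u) (v \in V i) * ((u \in V i) * c))).
  by apply: leq_sum => v _.
rewrite -big_distrl /= mulnC; case: (boolP (u \in V i)) => [uV|_]; last by rewrite !mul0n.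
have := sum_mem (V i); rewrite (bigD1 u) //= uV => <-.
by rewrite add1n /= leqnn.
Qed.

(** The sum is at most [|V| (|V| - 1)] for a tree and at most [2m (|V| - 1)] otherwise. Equality
    holds for a path on three vertices. *)
Lemma sum_sum_q i :
  \sum_u \sum_(v | v != u) q i u v + 4 * n <= (m i).*2 * n.+1 + 2.
Proof.
have := V_ge3 i; have := V_le i; have := V_len i; have := sum_deg i; have := sum_mem (V i).
have [tree|notree] := ltnP (m i) #|V i|; move=> sV sd Vn Vm V3.
  have : \sum_u \sum_(v | v != u) q i u v <= \sum_u (u \in V i) * #|V i|.-1.
    apply: leq_sum => u _; rewrite -[_ \in _ : nat]muln1; apply: sum_q => v.
    by rewrite /path_cap tree !inE; case: (0 < d i u); case: (0 < d i v).
  rewrite -big_distrl /= sV; move: tree Vn Vm V3; move: #|V i| (m i) n => a b c; nia.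
have : \sum_u \sum_(v | v != u) q i u v <= \sum_u d i u * #|V i|.-1.
  apply: leq_sum => u _; have -> : d i u = (u \in V i) * d i u.
    by rewrite inE; case: (d i u) => // ?; rewrite mul1n.
  apply: sum_q => v; rewrite /path_cap ltnNge notree /= !inE.
  by case: (d i v) (d i u) => [|?] [|?]; rewrite ?minn0 ?mul1n ?geq_minl.
rewrite -big_distrl /= sd; move: notree Vn Vm V3; move: #|V i| (m i) n => a b c.
move=> h1 h2 h3 h4 h5.
(* Here [a], [b], [c] are [|V|], [m], [n]. Since [a <= b], the claim reduces to
   [(a - 2)(c - a) >= 0]. *)
suff : c.*2 <= b * (c - a + 2) by nia.
by apply: (@leq_trans (a * (c - a + 2))); nia.
Qed.

(** The total capacity [K] over ordered pairs is bounded above by [sum_sum_q] and below by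
    [supp]. *)
Lemma bound_no_tight : (forall u, k < D u) ->
  k * n + #|I|.*2 <= (\sum_i m i).*2 + 2.
Proof.
move=> noT; have [u0 _] : exists u0 : T, u0 \in T by apply/card_gt0P; apply: leq_ltn_trans k_ltn.
have n4 : 4 <= n by have := D_ltn u0; have := noT u0; move: k_ge2; lia.
pose E2 := (\sum_i m i).*2; rewrite -/E2.
have sD : k.+1 * n <= E2.
  by rewrite /E2 -sum_D mulnC -sum_nat_const leq_sum // => u _; apply: noT.
pose K := \sum_i \sum_u \sum_(v | v != u) q i u v.
have K1 : K + 4 * n * #|I| <= E2 * n.+1 + 2 * #|I|.
  have -> : 4 * n * #|I| = \sum_(i : I) 4 * n by rewrite sum_nat_const mulnC.
  have -> : 2 * #|I| = \sum_(i : I) 2 by rewrite sum_nat_const mulnC.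
  rewrite /E2 -mul2n big_distrr big_distrl -!big_split /=; apply: leq_sum => i _.
  by rewrite mul2n; apply: sum_sum_q.
have card_neq (u : T) : \sum_(v | v != u) 1 = n.-1.
  by rewrite sum1_card -(cardC1 u); apply: eq_card => v; rewrite !inE.
have K2 : n * (n.-1 * k) + E2 <= K + n * n.-1.
  have -> : E2 = \sum_u \sum_(v | v != u) adj u v.
    rewrite /E2 -sum_D; apply: eq_bigr => u _; rewrite -card_adj -sum_mem (bigD1 u) //=.
    rewrite inE; case: (boolP (adj u u)) => [/adj_neq|_]; first by rewrite eqxx.
    by apply: eq_bigr => v _; rewrite inE.
  have -> : K = \sum_u \sum_(v | v != u) \sum_i q i u v.
    by rewrite /K exchange_big; apply: eq_bigr => u _; rewrite exchange_big.
  have cn (c : nat) : n * (n.-1 * c) = \sum_(u : T) \sum_(v | v != u) c.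
    rewrite -sum_nat_const; apply: eq_bigr => u _.
    by rewrite sum_nat_const -(card_neq u) sum1_card.
  rewrite cn -[n.-1 in X in _ <= X]muln1 cn -!big_split /=; apply: leq_sum => u _.
  rewrite -!big_split /=; apply: leq_sum => v vu; rewrite addn1.
  by apply: supp; rewrite eq_sym.
clearbody K E2; move: n4 sD K1 K2 k_ge2 k_le5; move: #|I| n => t N.
case: N => [//|N] /= N3 sD K1 K2 k2 k5.
rewrite leqNgt; apply/negP => lt.
(* If the bound failed, the degree sum [sD] would force [2t >= n + 3], where [n = N + 1]. *)
have t1 : N + 4 <= t.*2 by nia.
(* [K1] and [K2] give [2t(n - 1) <= n(n + k - 4)], and [k <= 5] makes the last factor at most
   [n + 1]. With [t1] this contradicts [n >= 4]. *)
have : t * (N.*2) <= N.+1 * N.+2 by nia.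
nia.
Qed.

(** The [k] paths to [u] use up the whole degree of [w], so each capacity equals the degree of [w];
    it is also at most the degree of [u]. *)
Lemma tight_adj w u i : D w = k -> adj w u -> d i w <= d i u.
Proof.
move=> tw wu; have le : \sum_j d j w <= \sum_j q j w u by rewrite -/(D w) tw; apply: supp_adj.
apply: leq_trans (q_le_r i w u); rewrite leqNgt; apply/negP => lt; move: le.
rewrite (bigD1 i) //= [X in _ <= X](bigD1 i) //= leqNgt => /negP; apply.
by rewrite -addSn leq_add //; apply: leq_sum => j _; apply: q_le_l.
Qed.

Lemma leq_minn_sum (P : pred I) (x : I -> nat) :
  minn 2 (\sum_(i | P i) x i) <= \sum_(i | P i) minn 2 (x i).
Proof.
apply: (big_ind2 (fun a b => minn 2 a <= b)) => [//|a b a' b'|//]; lia.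
Qed.

(** * The classes through a tight vertex and their excess *)

Section TightVertex.
Variable v : T.
Hypothesis tight : D v = k.

Definition colours_at := [set i | 0 < d i v].
Local Notation J := colours_at.
Definition deg_at u := \sum_(i in J) d i u.
Local Notation DJ := deg_at.
Definition deg_off u := \sum_(i | i \notin J) d i u.
Local Notation Dc := deg_off.
Definition deficient := [set u | DJ u < k].
Local Notation A := deficient.
Definition closed_nbhd := v |: [set u | adj v u].
Local Notation N := closed_nbhd.
Definition excess := \sum_u (DJ u - k).
Local Notation Y := excess.

Lemma D_split u : D u = DJ u + Dc u.
Proof. by rewrite /total_deg (bigID (mem J)). Qed.

Lemma DJ_tight : DJ v = k.
Proof.
rewrite -tight D_split [Dc v]big1 ?addn0 // => i; rewrite inE -eqn0Ngt => /eqP ->.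
by [].
Qed.

Lemma card_N : #|N| = k.+1.
Proof.
rewrite cardsU1 inE card_adj tight; case: (boolP (adj v v)) => // /adj_neq.
by rewrite eqxx.
Qed.

Lemma sum_minn u : k <= \sum_(i in J) minn (d i v) (d i u) + (u \notin N).
Proof.
have [->|nuv] := eqVneq u v.
  by rewrite /N setU11 addn0 -{1}DJ_tight leq_sum // => i _; rewrite minnn.
have := supp (_ : v != u); rewrite eq_sym => /(_ nuv); rewrite !inE (negbTE nuv) /=.
have : \sum_i q i v u <= \sum_(i in J) minn (d i v) (d i u).
  rewrite (bigID (mem J)) /= [X in _ + X]big1 ?addn0.
    by apply: leq_sum => i _; rewrite leq_min q_le_l q_le_r.
  by move=> i; rewrite inE -eqn0Ngt => /eqP d0; apply/eqP; rewrite -leqn0 -d0 q_le_l.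
by case: (adj v u); lia.
Qed.

Lemma DJ_ge u : k <= DJ u + (u \notin N).
Proof.
apply: leq_trans (sum_minn u) _; rewrite leq_add2r leq_sum // => i _; exact: geq_minr.
Qed.

Lemma DJ_A u : u \in A -> (DJ u).+1 = k.
Proof. by rewrite inE; have := DJ_ge u; lia. Qed.

Lemma sum_DJ : \sum_u DJ u + #|A| = k * n + Y.
Proof.
rewrite /excess -sum_mem mulnC -sum_nat_const -!big_split /=; apply: eq_bigr => u _.
by rewrite inE; have := DJ_ge u; lia.
Qed.

Lemma sum_Dc : \sum_u Dc u = (\sum_(i | i \notin J) m i).*2.
Proof.
rewrite exchange_big -muln2 big_distrl /=; apply: eq_bigr => i _.
by rewrite muln2 sum_deg.
Qed.

(* If a class avoiding v contains a tight vertex of A, it contains all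
   neighbours of that vertex, which leaves only a path on three vertices
   with k = 2 to be excluded separately. *)
Lemma card_A_class j w : w \in A -> Dc w = 1 -> j \notin J -> 0 < d j w ->
  #|A :&: V j| <= (m j).*2 - 2.
Proof.
move=> wA Dw jJ dw.
have Vm := V_le j; have mj := Fedges j; have V3 := V_ge3 j.
have [V4|V4] := leqP 4 #|V j|.
  by have := subset_leq_card (subsetIr A (V j)); lia.
have tw : D w = k by rewrite D_split Dw addn1 DJ_A.
have subV : w |: [set u | adj w u] \subset V j.
  apply/subsetP => u; rewrite in_setU1 in_support => /orP[/eqP->//|].
  by rewrite inE => wu; apply: leq_trans dw (tight_adj _ tw wu).
have k2 : k = 2.
  have := subset_leq_card subV; rewrite cardsU1 inE card_adj tw.
  case: (boolP (adj w w)) => [/adj_neq|_]; first by rewrite eqxx.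
  by move: k_ge2; lia.
have DJw : DJ w = 1 by have := DJ_A wA; lia.
have [i iJ dwi] : exists2 i, i \in J & 0 < d i w.
  apply/exists_inP; rewrite -[X in is_true X]negbK; apply/negP.
  rewrite negb_exists_in => /forall_inP h.
  by move: DJw; rewrite /deg_at big1 // => i /h; rewrite -eqn0Ngt => /eqP.
have /degP[a wa] := dwi.
have aV : a \in V j.
  by apply: (subsetP subV); rewrite !inE; apply/orP; right; apply/existsP; exists i.
have leDJ u : d i u <= DJ u by rewrite /deg_at (bigD1 i) //= leq_addr.
(* If [a] were deficient too, the edge [wa] would be a whole component of class [i], which is
   connected on at least three vertices. *)
have aA : a \notin A.
  apply/negP => /DJ_A DJa.
  have [z zV zS] : exists2 z, z \in V i & z \notin [set w; a].
    apply/subsetPn/negP => /subset_leq_card.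
    by have := V_ge3 i; rewrite cards2; case: (w != a) => /=; lia.
  have wV : w \in V i by rewrite in_support.
  have [u [u' [uu' uS u'S]]] := connect_crossing (Fconn wV zV) (set21 w a) zS.
  have one u1 u2 u3 : DJ u1 = 1 -> F i u1 u2 -> F i u1 u3 -> u2 = u3.
    move=> D1 f2 f3; have /card_le1_eqP : d i u1 <= 1 by rewrite -D1.
    by apply; rewrite inE.
  move: uS u'S; rewrite !inE negb_or => /orP[]/eqP E /andP[u'w u'a]; rewrite E in uu'.
    by rewrite (one w u' a DJw uu' wa) eqxx in u'a.
  have DJa1 : DJ a = 1 by move: DJa; rewrite k2 => -[].
  by rewrite (one a u' w DJa1 uu') ?eqxx // Fsym in u'w.
have : A :&: V j \proper V j.
  apply/properP; split; first exact: subsetIr.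
  by exists a => //; rewrite inE (negbTE aA).
by move=> /proper_card; lia.
Qed.

(** A discharging argument: through [om] each deficient vertex receives at least 2 from the classes
    avoiding [v], its share being doubled when its degree there is only 1, and a class with [m]
    edges gives at most [4m - 4]. *)
Lemma card_A : #|A| + #|~: J|.*2 <= (\sum_(j | j \notin J) m j).*2.
Proof.
pose om j u := if u \in A then (if Dc u == 1 then (d j u).*2 else minn 2 (d j u)) else 0.
have om_ge u : (u \in A).*2 <= \sum_(j | j \notin J) om j u.
  rewrite /om; case: (boolP (u \in A)) => //= uA.
  have Dc1 : 1 <= Dc u by have := D_ge u; rewrite D_split; have := DJ_A uA; lia.
  case: eqP => [E|E].
    by under eq_bigr => j _ do rewrite -muln2; rewrite -big_distrl /= -/(Dc u) E.
  by apply: leq_trans (leq_minn_sum _ _); rewrite -/(Dc u); lia.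
have om_le j : j \notin J -> \sum_u om j u + 4 <= 4 * m j.
  move=> jJ; have m2 := Fedges j.
  (* A class with a doubled vertex is covered by [card_A_class]; in any other the weights are at
     most the degrees, and [2m <= 4m - 4]. *)
  case: (boolP [exists u, [&& u \in A, Dc u == 1 & 0 < d j u]]) => [/existsP[w]|no].
    move=> /and3P[wA /eqP Dw dw].
    have cA := card_A_class wA Dw jJ dw.
    suff : \sum_u om j u <= 2 * #|A :&: V j| by lia.
    rewrite -sum_mem big_distrr /=; apply: leq_sum => u _; rewrite /om in_setI in_support.
    case: (u \in A) => //=; case: eqP => [E|_]; last first.
      by case: (d j u) => //= *; rewrite muln1 geq_minl.
    have : d j u <= Dc u by rewrite /deg_off (bigD1 j) //= leq_addr.
    by rewrite E; case: (d j u) => [|[|?]].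
  suff : \sum_u om j u <= \sum_u d j u by rewrite sum_deg; lia.
  apply: leq_sum => u _; rewrite /om; case: (boolP (u \in A)) => // uA.
  case: eqP => [E|_]; last exact: geq_minr.
  move: no; rewrite negb_exists => /forallP/(_ u); rewrite uA E eqxx /= -eqn0Ngt => /eqP->.
  by [].
have lo : #|A|.*2 <= \sum_(j | j \notin J) \sum_u om j u.
  rewrite exchange_big -sum_mem -mul2n big_distrr /=; apply: leq_sum => u _.
  by rewrite mul2n; apply: om_ge.
have hi : \sum_(j | j \notin J) \sum_u om j u + 4 * #|~: J| <= 4 * \sum_(j | j \notin J) m j.
  have -> : 4 * #|~: J| = \sum_(j | j \notin J) 4.
    by rewrite mulnC -sum_nat_const; apply: eq_bigl => j; rewrite inE.
  rewrite -big_split big_distrr /=; apply: leq_sum => j jJ; exact: om_le.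
by lia.
Qed.

(** By [card_A] the classes avoiding [v] pay for the deficient vertices and for themselves, so the
    excess only has to cover the classes through [v]. *)
Lemma bound_of_excess : #|J|.*2 <= Y + 2 ->
  k * n + #|I|.*2 <= (\sum_i m i).*2 + 2.
Proof.
move=> sY; rewrite -sum_D; under eq_bigr => u _ do rewrite D_split.
rewrite big_split /= sum_Dc; have := card_A; have := sum_DJ.
have := cardsC J; move: sY; move: (k * n) Y #|A| #|I| #|J| #|~: J| (\sum_u DJ u).
move: (\sum_(j | j \notin J) m j) => *; lia.
Qed.

Definition single_colours := [set i | d i v == 1].
Local Notation R := single_colours.

Lemma R_sub_J : R \subset J.
Proof. by apply/subsetP => i; rewrite !inE => /eqP->. Qed.

Lemma card_J : #|J|.*2 <= k + #|R|.
Proof.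
have -> : #|R| = \sum_(i in J) (i \in R).
  rewrite -sum_mem [RHS]big_mkcond /=; apply: eq_bigr => i _.
  by case: (boolP (i \in R)) => [/(subsetP R_sub_J)->//|_]; case: ifP.
rewrite -muln2 -sum_nat_const -[k in _ <= k + _]DJ_tight -big_split /=; apply: leq_sum => i.
by rewrite !inE; case: (d i v) => [|[|?]].
Qed.

Lemma sum_pred_deg i : #|V i| <= \sum_u (d i u).-1 + 2.
Proof.
have : \sum_u (d i u).-1 + #|V i| = (m i).*2.
  rewrite -sum_deg -sum_mem -big_split /=; apply: eq_bigr => u _.
  by rewrite in_support; case: (d i u) => // ?; rewrite addn1.
by have := V_le i; lia.
Qed.

Lemma sum_notin_N : \sum_u (u \notin N) + k.+1 = n.
Proof.
rewrite -card_N -(cardsC N) addnC; congr (_ + _); rewrite -sum_mem.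
by apply: eq_bigr => u _; rewrite in_setC.
Qed.

(** A class of [R] carries at most one path to [v], so further edges of [u] in it are excess, up to
    the one path that may be missing outside [N]. *)
Lemma excess_R u : \sum_(i in R) (d i u).-1 <= DJ u - k + (u \notin N).
Proof.
suff : \sum_(i in J) minn (d i v) (d i u) + \sum_(i in R) (d i u).-1 <= DJ u.
  by have := sum_minn u; lia.
have -> : \sum_(i in R) (d i u).-1 = \sum_(i in J) (i \in R) * (d i u).-1.
  rewrite big_mkcond /= [RHS]big_mkcond; apply: eq_bigr => i _.
  by case: (boolP (i \in R)) => [/(subsetP R_sub_J)->|]; rewrite ?mul1n //; case: ifP.
rewrite -big_split; apply: leq_sum => i _ /=; rewrite inE.
by case: eqP => [->|_]; lia.
Qed.

(** By tightness [N] lies in [V i]. Connectedness yields [|V i| - 2] surplus edge ends in class [i],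
    of which at most [|V i| - (k + 1)] are lost outside [N]. *)
Lemma excess_one i : i \in R -> k <= Y + 1.
Proof.
move=> iR; have dv : d i v = 1 by move: iR; rewrite inE => /eqP.
have NV : N \subset V i.
  apply/subsetP => u; rewrite in_setU1 in_support => /orP[/eqP->|]; first by rewrite dv.
  by rewrite inE => vu; rewrite -dv; apply: tight_adj.
have : \sum_u (d i u).-1 <= \sum_u ((DJ u - k) + (u \in V i :\: N)).
  apply: leq_sum => u _; rewrite in_setD in_support.
  have := excess_R u; rewrite (bigD1 i) //=.
  by case: (d i u) => [|?] //=; rewrite andbT; lia.
rewrite big_split /= sum_mem cardsD (setIidPr NV) card_N -/Y.
by have := sum_pred_deg i; have := subset_leq_card NV; rewrite card_N; lia.
Qed.

(** The same surplus summed over [R]. For [h3], a vertex is missed by at most one class of [R], and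
    only if it lies outside [N]. *)
Lemma excess_many : #|R| * n + 2 * k.+1 <= Y + 2 * n + 2 * #|R|.
Proof.
have h1 : \sum_(i in R) #|V i| <= \sum_u \sum_(i in R) (d i u).-1 + 2 * #|R|.
  rewrite exchange_big /= mulnC -sum_nat_const -big_split /=; apply: leq_sum => i _.
  exact: sum_pred_deg.
have h2 : \sum_u \sum_(i in R) (d i u).-1 <= Y + \sum_u (u \notin N).
  by rewrite /excess -big_split /=; apply: leq_sum => u _; apply: excess_R.
have h3 : #|R| * n <= \sum_(i in R) #|V i| + \sum_u (u \notin N).
  have -> : \sum_(i in R) #|V i| = \sum_u \sum_(i in R) (u \in V i).
    by rewrite exchange_big; apply: eq_bigr => i _; rewrite sum_mem.
  rewrite -big_split mulnC -sum_nat_const; apply: leq_sum => u _ /=.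
  suff : \sum_(i in J) minn (d i v) (d i u) + #|R| <= DJ v + \sum_(i in R) (u \in V i).
    by rewrite DJ_tight; have := sum_minn u; lia.
  rewrite /deg_at (big_setID R) /= [X in _ <= X + _](big_setID R) /= (setIidPr R_sub_J).
  rewrite addnAC [X in _ <= X]addnAC leq_add //; last first.
    by apply: leq_sum => i _; apply: geq_minl.
  rewrite -sum1_card -!big_split /=; apply: leq_sum => i; rewrite inE => /eqP ->.
  by rewrite in_support; case: (d i u) => // ?; rewrite addnC leq_add2l geq_minl.
by have := sum_notin_N; lia.
Qed.

Lemma bound_tight : #|J| <= 1 \/ (exists i, d i v = 1) ->
  k * n + #|I|.*2 <= (\sum_i m i).*2 + 2.
Proof.
move=> h; apply: bound_of_excess; case: h => [J1|[i dv]]; first by lia.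
have iR : i \in R by rewrite inE dv.
have := card_J; have := excess_one iR; have := excess_many; have := subset_leq_card R_sub_J.
have : 0 < #|R| by apply/card_gt0P; exists i.
(* One class in [R] is settled by [excess_one] and [2|J| <= k + 1]; for two or more, [excess_many]
   gives [Y + 2 >= 2k], while [|J| <= k]. *)
have := k_ltn; move: (#|R|) (#|J|) Y n => r s y c; case: r => [//|[|r]]; nia.
Qed.
End TightVertex.

Lemma sum_constT (c : nat) : \sum_(u : T) c = c * n.
Proof. by rewrite sum_nat_const mulnC. Qed.

(** * A tight vertex in exactly two classes *)

Section TwoClasses.
Variables (v : T) (i1 i2 : I).
Hypothesis tight : D v = k.
Hypothesis Jv : colours_at v = [set i1; i2].
Hypothesis i12 : i1 != i2.
Hypothesis dv1 : d i1 v = 2.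
Hypothesis dv2 : 2 <= d i2 v.
Hypothesis no_single : forall u i, D u = k -> d i u != 1.

Lemma deg_at2 u : deg_at v u = d i1 u + d i2 u.
Proof. by rewrite /deg_at Jv big_setU1 ?inE // big_set1. Qed.

Lemma dv2E : (d i2 v).+2 = k.
Proof. by rewrite -(DJ_tight tight) deg_at2 dv1. Qed.

(** A tight vertex has degree at least [k - 1] in the two classes, so a positive degree elsewhere
    would be 1, against [no_single]. *)
Lemma deg_off_tight u : D u = k -> deg_off v u = 0.
Proof.
move=> tu; apply/eqP; rewrite sum_nat_eq0; apply/forall_inP => i iJ; apply/negPn; rewrite -lt0n.
apply/negP => di; have := no_single i tu; have := D_split v u; have := DJ_ge tight u.
by rewrite /deg_off (bigD1 i) //=; case: (_ \notin _) => /=; lia.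
Qed.

Definition same_type := [set u | [&& D u == k, d i1 u == 2 & d i2 u == d i2 v]].
Definition loose := [set u | (k < D u) && (k <= deg_at v u)].

(** By [tight_adj] both degrees of [w] are at least those of [u], so [w] either repeats them and is
    tight or has [D w > k]. *)
Lemma same_type_adj u w : u \in same_type -> adj u w -> w \in same_type :|: loose.
Proof.
rewrite !inE => /and3P[/eqP tu /eqP u1 /eqP u2] uw.
have := tight_adj i1 tu uw; have := tight_adj i2 tu uw; have := D_split v w.
rewrite deg_at2 u1 u2; have := D_ge w; have := dv2E; lia.
Qed.

Lemma v_same_type : v \in same_type.
Proof. by rewrite inE tight dv1 !eqxx. Qed.

(* Every path leaving [same_type] does so through [loose]. *)
Lemma card_loose w : w \notin same_type :|: loose -> k <= #|loose|.+1.
Proof.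
move=> wN; have nvw : v != w by apply: contraNneq wN => <-; rewrite inE v_same_type.
have [Q [col PS]] := Fpaths nvw; have [[Qi Qd] Qu Qp Qn] := PS.
have ex a : col a != None -> exists2 z, z \in Q a & z \in loose.
  case E: (col a) => [i|//] _; have pa := Qp _ _ E.
  have lw : last v (rcons (Q a) w) \notin same_type.
    by rewrite last_rcons; move: wN; rewrite inE negb_or => /andP[].
  have [u [z [uz uS zS zs]]] := path_crossing pa v_same_type lw.
  have zL : z \in loose.
    have /(same_type_adj uS) : adj u z by apply/existsP; exists i.
    by rewrite inE (negbTE zS).
  exists z => //; move: zs; rewrite mem_rcons inE => /orP[/eqP zw|//].
  by move: wN; rewrite -zw inE zL orbT.
pose f a := odflt v [pick z in Q a | z \in loose].
have fP a : col a != None -> f a \in Q a /\ f a \in loose.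
  move=> /ex[z zQ zL]; rewrite /f; case: pickP => [u /andP[]//|/(_ z)].
  by rewrite zQ zL.
have fi : {in [set a | col a != None] &, injective f}.
  move=> a b; rewrite !inE => /fP[a1 _] /fP[b1 _] E.
  by apply/eqP/contraT => /Qd/(_ _ a1); rewrite E b1.
have : #|[set a | col a != None]| <= #|loose|.
  rewrite -(card_in_imset fi); apply: subset_leq_card; apply/subsetP => _ /imsetP[a + ->].
  by rewrite inE => /fP[].
have := cardsC [set a | col a == None]; rewrite card_ord.
have -> : ~: [set a | col a == None] = [set a | col a != None] by apply/setP => a; rewrite !inE.
have := cnt_none PS; lia.
Qed.

(* In a 2-regular class the two paths from v to a neighbour exhaust all vertices. *)
Lemma two_regular : (forall u, d i1 u = 2) -> False.
Proof.
move=> reg; have /degP[u vu] : 0 < d i1 v by rewrite dv1.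
have vua : adj v u by apply/existsP; exists i1.
have nvu := adj_neq vua.
have [Q [col PS]] := Fpaths nvu; have [[Qi Qd] Qu Qp Qn] := PS.
(* All [k] paths to the neighbour [u] run in classes and [v] is tight, so every class edge at [v] is
   used. *)
have cntE i : d i v <= cnt col i.
  rewrite leqNgt; apply/negP => lt; have := sum_cnt col; rewrite (cnt_none_adj PS vua) addn0.
  rewrite -tight /total_deg (bigD1 i) //= [X in _ = X](bigD1 i) //= => E.
  have : \sum_(j | j != i) cnt col j <= \sum_(j | j != i) d j v.
    by apply: leq_sum => j _; apply: cnt_le_l PS j.
  by move: E lt; lia.
have [c] : exists c, c \in [set a | col a == Some i2].
  by apply/card_gt0P; apply: leq_trans (cntE i2); apply: ltnW.
rewrite inE => /eqP cc.
have [z zc] : exists z, z \in Q c.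
  have := Qp c _ cc; case: (Q c) => [|z s] /=; last by exists z; rewrite mem_head.
  by rewrite andbT => vu2; move: i12; rewrite (Fdisj vu vu2) eqxx.
(* [C] consists of the vertices on the paths in class [i1]. It turns out closed under neighbours in
   [i1], yet it misses the interior vertex [z] of a path in [i2]. *)
pose C := [set z | [|| z == v, z == u | [exists a, (col a == Some i1) && (z \in Q a)]]].
have inC a w : col a = Some i1 -> w \in v :: rcons (Q a) u -> w \in C.
  move=> ca; rewrite !inE mem_rcons inE => /or3P[->//|->|wa]; first by rewrite orbT.
  by apply/or3P/Or33/existsP; exists a; rewrite ca eqxx.
have zC : z \notin C.
  have := Qu c => /= /andP[vc]; rewrite rcons_uniq => /andP[uc _].
  rewrite !inE; apply/negP => /or3P[/eqP E|/eqP E|/existsP[a /andP[/eqP ca za]]].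
  - by move: vc; rewrite mem_rcons inE -E zc orbT.
  - by rewrite E (negbTE uc) in zc.
  - have /Qd/(_ _ zc) : c != a.
      by apply: contraNneq i12 => E; move: cc; rewrite E ca => -[->].
    by rewrite za.
have vC : v \in C by rewrite inE eqxx.
have conn : connect (F i1) v z by apply: Fconn; rewrite in_support reg.
have [p [w [pw pC]]] := connect_crossing conn vC zC.
apply/negP/negPn; move: pC; rewrite inE => /or3P[/eqP E|/eqP E|/existsP[a /andP[/eqP ca pa]]].
- rewrite {}E in pw; have [a ca ->] := head_surj PS (cntE i1) pw.
  by apply: inC ca _; rewrite inE orbC; case: (Q a) => [|b s]; rewrite /= inE eqxx.
- rewrite {}E in pw; have le : d i1 u <= cnt col i1 by rewrite reg -dv1.
  have [a ca ->] := last_surj PS le pw.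
  apply: inC ca _; have := mem_last v (Q a).
  by rewrite !inE mem_rcons inE => /orP[->//|->]; rewrite !orbT.
- apply: (inC _ _ ca); apply: (path_interior_nbr (Fsym i1) (Qp _ _ ca) (Qu a) pa) => //.
  by rewrite reg.
Qed.

Lemma adj_sym u w : adj u w = adj w u.
Proof. by apply: eq_existsb => i; rewrite Fsym. Qed.

Lemma bound_two_classes : 4 <= k -> k * n + #|I|.*2 <= (\sum_i m i).*2 + 2.
Proof.
move=> k4; have cJ : #|colours_at v| = 2 by rewrite Jv cards2 i12.
have cI := cardsC (colours_at v); rewrite cJ in cI.
have Ec : 2 * #|~: colours_at v| <= \sum_(i | i \notin colours_at v) m i.
  rewrite mulnC -sum_nat_const; under eq_bigl => i do rewrite inE.
  by apply: leq_sum => i _; apply: Fedges.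
have sDc := sum_Dc v; have sD := sum_D.
case: (boolP [exists w, w \notin same_type :|: loose]) => [/existsP[w /card_loose cL]|noW].
  (* Each loose vertex adds 1 to the doubled bound, which needs 4 more. As [k >= 4] there are at
     least three loose vertices, and parity supplies the rest. *)
  have : \sum_u ((u \in loose) + deg_off v u + k.*2) <= \sum_u (D u * 2).
    apply: leq_sum => u _; have := D_split v u; have := D_ge u.
    have : k <= (deg_at v u).+1 by have := DJ_ge tight u; case: (_ \notin _); lia.
    have [tu|nt] := eqVneq (D u) k; first by rewrite deg_off_tight // inE tu ltnn; lia.
    by rewrite inE; lia.
  rewrite -big_distrl !big_split /= sum_mem sum_constT sD sDc -doubleMl.
  move: k4 cL Ec cI; clear; move: (k * n) (\sum_(i | i \notin colours_at v) m i) #|loose| #|I|.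
  move: #|~: colours_at v| (\sum_i m i) => *; lia.
have inTW u : u \in same_type :|: loose.
  by move: noW; rewrite negb_exists => /forallP/(_ u); rewrite negbK.
have DJk u : k <= deg_at v u.
  have := inTW u; rewrite !inE => /orP[/and3P[_ /eqP u1 /eqP u2]|/andP[]//].
  by rewrite deg_at2 u1 u2 -dv2E.
have lo : k * n + (\sum_(i | i \notin colours_at v) m i).*2 <= (\sum_i m i).*2.
  rewrite -sD -sDc mulnC -sum_nat_const -big_split; apply: leq_sum => u _ /=.
  by have := D_split v u; have := DJk u; lia.
case: (posnP #|~: colours_at v|) => [c0|]; last by lia.
rewrite leqNgt; apply/negP => lt; apply: two_regular.
have small : (\sum_i m i).*2 <= k * n + 1 by lia.
(* By [small] there is at most one unit of excess, so two adjacent vertices are not both loose; a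
   loose vertex thus inherits degrees from a neighbour in [same_type]. *)
have d12 u : 2 <= d i1 u /\ d i2 v <= d i2 u.
  have := inTW u; rewrite in_setU => /orP[|uL]; first by rewrite inE => /and3P[_ /eqP-> /eqP->].
  have [w uw] : exists w, w \in [set w | adj u w].
    by apply/card_gt0P; rewrite card_adj; apply: leq_trans (D_ge u); apply: ltnW.
  rewrite inE in uw; have wS : w \in same_type.
    have := inTW w; rewrite in_setU => /orP[//|wL].
    have : \sum_z (k + (z \in [set u; w])) <= \sum_z D z.
      apply: leq_sum => z _; rewrite !inE; have := D_ge z.
      move: uL wL; rewrite !inE => /andP[uk _] /andP[wk _].
      by case: eqP => [->|_]; [lia|case: eqP => [->|_]; lia].
    rewrite big_split /= sum_mem cards2 (adj_neq uw) sum_constT sD.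
    by move: small; lia.
  move: wS; rewrite inE => /and3P[/eqP tw /eqP w1 /eqP w2].
  by rewrite -w1 -w2; split; apply: tight_adj => //; rewrite adj_sym.
have s1 : n * 2 <= \sum_u d i1 u.
  by rewrite -sum_nat_const leq_sum // => u _; case: (d12 u).
have s2 : n * d i2 v <= \sum_u d i2 u.
  by rewrite -sum_nat_const leq_sum // => u _; case: (d12 u).
have s12 : \sum_u d i1 u + \sum_u d i2 u <= (\sum_i m i).*2.
  rewrite -sD -big_split leq_sum // => u _ /=; rewrite -deg_at2.
  by have := D_split v u; lia.
(* The sum is even by the handshake lemma, which removes the one spare unit. *)
have s1' : \sum_u d i1 u <= n * 2.
  move: s1 s2 s12 small; rewrite -dv2E sum_deg; move: (\sum_u d i2 u) (m i1) (\sum_i m i).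
  by move=> a b c; nia.
move=> u; apply/eqP; rewrite eqn_leq; case: (d12 u) => -> _; rewrite andbT leqNgt.
apply/negP => du; move: s1'; rewrite -sum_nat_const (bigD1 u) //= [X in _ <= X](bigD1 u) //=.
rewrite leqNgt => /negP; apply; rewrite -addSn leq_add // leq_sum // => w _.
by case: (d12 w).
Qed.
End TwoClasses.

Theorem bound_classes : k * n + #|I|.*2 <= (\sum_i m i).*2 + 2.
Proof.
rewrite leqNgt; apply/negP => lt.
case: (boolP [exists v, D v == k]) => [/existsP[v /eqP tv]|]; last first.
  rewrite negb_exists => /forallP nt; move: lt; rewrite ltnNge bound_no_tight // => u.
  by rewrite ltn_neqAle eq_sym nt D_ge.
have notS u i : D u = k -> d i u != 1.
  move=> tu; apply/eqP => du; move: lt; rewrite ltnNge (bound_tight tu) //.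
  by right; exists i.
have J2 : 1 < #|colours_at v|.
  by rewrite ltnNge; apply/negP => J1; move: lt; rewrite ltnNge (bound_tight tv) //; left.
have R0 : #|single_colours v| = 0.
  by apply/eqP; rewrite cards_eq0; apply/eqP/setP => i; rewrite !inE (negbTE (notS _ _ tv)).
have := card_J tv; rewrite R0 addn0 => cJ.
(* Each class at [v] takes at least 2 of the degree [k <= 5], so there are exactly two, and one of
   them has degree 2. *)
have /cards2P[i1 [i2 [i12 Jv]]] : #|colours_at v| == 2 by move: J2 cJ k_le5; lia.
have k4 : 4 <= k by move: J2 cJ; lia.
have d2 i : i \in colours_at v -> 2 <= d i v.
  by rewrite inE; have := notS _ i tv; lia.
have [d1 d1'] : 2 <= d i1 v /\ 2 <= d i2 v by split; apply: d2; rewrite Jv ?set21 ?set22.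
have E : d i1 v + d i2 v = k by rewrite -(DJ_tight tv) /deg_at Jv big_setU1 ?inE // big_set1.
have [e1|e1] := eqVneq (d i1 v) 2.
  by move: lt; rewrite ltnNge (@bound_two_classes v i1 i2).
have e2 : d i2 v = 2 by move: k_le5; lia.
move: lt; rewrite ltnNge (@bound_two_classes v i2 i1) //; first by rewrite setUC.
by rewrite eq_sym.
Qed.
End ColourClasses.

(** * Components of the colour classes *)

Section Components.
Variables (T : finType) (e : rel T) (c : colouring T) (k : nat).
Hypothesis e_sym : symmetric e.
Hypothesis e_irr : irreflexive e.

Local Notation colr a := (colour_rel e c a).

Lemma colour_rel_sym a : symmetric (colr a).
Proof. by move=> u v; rewrite /colour_rel /= e_sym setUC. Qed.

Definition colour_bound := (\max_(A in edges e) c A).+1.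

(** A component is named by its colour and its root; pairs whose vertex is not a root give the empty
    relation. [colour_bound] keeps the index type finite. *)
Definition comp_rel (p : 'I_colour_bound * T) : rel T :=
  fun u v => colr p.1 u v && (root (colr p.1) u == p.2).

Lemma root_colour_rel a u v : colr a u v -> root (colr a) u = root (colr a) v.
Proof.
by move=> uv; apply/(rootP (sym_connect_sym (colour_rel_sym a))); apply: connect1.
Qed.

Lemma comp_rel_sym p : symmetric (comp_rel p).
Proof.
move=> u v; rewrite /comp_rel colour_rel_sym; case: (boolP (colr _ v u)) => //= vu.
by rewrite (root_colour_rel vu).
Qed.

Lemma comp_rel_irr p : irreflexive (comp_rel p).
Proof. by move=> u; rewrite /comp_rel /colour_rel /= e_irr. Qed.

Lemma comp_rel_disj p p' x y : comp_rel p x y -> comp_rel p' x y -> p = p'.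
Proof.
case: p p' => [a r] [a' r'] /andP[/andP[_ /eqP /= E] /eqP <-] /andP[/andP[_ /eqP /= E'] /eqP <-].
have -> : a = a' by apply: val_inj; apply: etrans (esym E) E'.
by [].
Qed.

Lemma comp_rel_path (p : 'I_colour_bound * T) x s :
  root (colr p.1) x = p.2 -> path (colr p.1) x s -> path (comp_rel p) x s.
Proof.
elim: s x => //= y s IH x rx /andP[xy ps]; rewrite /comp_rel xy rx eqxx /=.
by apply: IH => //; rewrite -(root_colour_rel xy).
Qed.

Lemma comp_rel_conn p : {in support (comp_rel p) &, forall x y, connect (comp_rel p) x y}.
Proof.
move=> x y; rewrite !inE => /card_gt0P[x']; rewrite inE => /andP[_ /eqP rx].
move=> /card_gt0P[y']; rewrite inE => /andP[_ /eqP ry].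
have /connectP[s ps ->] : connect (colr p.1) x y.
  by apply/(rootP (sym_connect_sym (colour_rel_sym _))); rewrite rx ry.
by apply/connectP; exists s => //; apply: comp_rel_path.
Qed.

Lemma colour_ltn u v : e u v -> c [set u; v] < colour_bound.
Proof. by move=> uv; rewrite ltnS (leq_bigmax_cond _ (mem_edges uv)). Qed.

Definition big_classes := [set p | 2 <= nedges (comp_rel p)].
Definition big_class := {p | p \in big_classes}.

Lemma big_class_edges (i : big_class) : 2 <= nedges (comp_rel (val i)).
Proof. by have := valP i; rewrite inE. Qed.

(** A monochromatic path stays in one component. In a component with a single edge it is that edge,
    since a nonempty interior would supply two. *)
Lemma big_class_paths x y : k_mono_connected_pair k e c x y ->
  exists Q col, @path_system T big_class (fun i => comp_rel (val i)) k x y Q col.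
Proof.
move=> [P [Pi [Pm Pd]]].
have Pu i : uniq (x :: rcons (P i) y) by have [a /andP[]] := Pm i.
pose cl i := [pick p | path (comp_rel p) x (rcons (P i) y)].
have clP i : exists2 p, cl i = Some p & path (comp_rel p) x (rcons (P i) y).
  have [a /andP[pa _]] := Pm i; rewrite /cl; case: pickP => [p pp|no]; first by exists p.
  have ltA : a < colour_bound.
    move: pa; case: (rcons _ _) (size_rcons (P i) y) => //= b s _ /andP[/andP[xb /eqP <-] _].
    exact: colour_ltn.
  have /negP[] := negbT (no (Ordinal ltA, root (colr a) x)).
  exact: comp_rel_path.
exists P, (fun i => obind insub (cl i)); split=> //.
  move=> a i; have [p -> pp] := clP a; rewrite /=; case: insubP => // j _ jp [<-].
  by rewrite jp.
move=> a; have [p -> pp] := clP a; rewrite /=; case: insubP => //; rewrite inE => small _.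
have Pa : P a = [::].
  have := Pu a; case: (P a) pp => // b s /= /andP[xb ps] /andP[xs _].
  case/negP: small; have [z [bz xz]] : exists z, comp_rel p b z /\ x != z.
    exists (head y s); split; first by case: (s) ps => [|z r] /= /andP[].
    apply: contraNneq xs => ->; rewrite inE; apply/orP; right.
    by case: (s) => [|z r]; rewrite /= inE eqxx.
  apply/card_gt1P; exists [set x; b], [set b; z]; split; [exact: mem_edges|exact: mem_edges|].
  apply: contraTneq (set21 x b) => ->; rewrite !inE negb_or xz andbT.
  by apply: contraNneq xs => ->; rewrite mem_head.
split=> // i; apply: contra small => xyi; rewrite Pa /= andbT in pp.
by rewrite (comp_rel_disj pp xyi); apply: big_class_edges.
Qed.

Lemma sum_comp_edges : \sum_p nedges (comp_rel p) <= nedges e.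
Proof.
have -> : \sum_p nedges (comp_rel p) = \sum_A \sum_p (A \in edges (comp_rel p)).
  by rewrite exchange_big; apply: eq_bigr => p _; rewrite sum_mem.
rewrite /nedges -sum_mem; apply: leq_sum => A _.
case: (boolP [exists p, A \in edges (comp_rel p)]) => [/existsP[p Ap]|no]; last first.
  rewrite big1 // => p _; apply/eqP; rewrite eqb0; apply: contra no => Ap.
  by apply/existsP; exists p.
have /edgesP[u [v [EA uv]]] := Ap.
have -> : A \in edges e by rewrite EA mem_edges //; move: uv => /andP[/andP[]].
rewrite (bigD1 p) //= Ap big1 // => p' np; apply/eqP; rewrite eqb0; apply: contra np.
move=> /edgesP[u' [v' [EA' uv']]]; apply/eqP.
have: u' \in [set u; v] by rewrite -EA EA' set21.
have: v' \in [set u; v] by rewrite -EA EA' set22.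
rewrite !inE => /orP[]/eqP Ev /orP[]/eqP Eu; rewrite Ev Eu in uv'.
- by rewrite comp_rel_irr in uv'.
- by rewrite comp_rel_sym in uv'; apply: comp_rel_disj uv' uv.
- exact: comp_rel_disj uv' uv.
- by rewrite comp_rel_irr in uv'.
Qed.

(** Splitting colours into components does not lower the count: every used colour is [p.1] for a
    nonempty class. *)
Lemma ncolours_le : ncolours e c <= #|[set p | 0 < nedges (comp_rel p)]|.
Proof.
rewrite cardE -(size_map (fun p => val p.1)); apply: uniq_leq_size; first exact: undup_uniq.
move=> a; rewrite mem_undup => /mapP[A]; rewrite mem_enum => /edgesP[u [v [EA uv]]] ->.
subst A; pose A := [set u; v]; rewrite -/A.
have ltc : c A < colour_bound by apply: colour_ltn.
apply/mapP; exists (Ordinal ltc, root (colr (c A)) u) => //.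
rewrite mem_enum inE; apply/card_gt0P; exists A; apply: mem_edges.
by rewrite /comp_rel /= /colour_rel /= uv !eqxx.
Qed.

Lemma ncolours_bound : 2 <= k <= 5 -> k < #|T| -> mono_k_connected k e c ->
  k * #|T| + (ncolours e c).*2 <= (nedges e).*2 + 2.
Proof.
move=> /andP[k2 k5] kn mono.
have := @bound_classes T big_class (fun i => comp_rel (val i)) k
  (fun i => comp_rel_sym (val i)) (fun i => comp_rel_irr (val i)) _
  (fun i => comp_rel_conn (p := val i)) big_class_edges
  (fun x y nxy => big_class_paths (mono x y nxy)) k2 k5 kn.
have dis (i j : big_class) x y : comp_rel (val i) x y -> comp_rel (val j) x y -> i = j.
  by move=> h1 h2; apply: val_inj; apply: comp_rel_disj h1 h2.
move=> /(_ dis).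
have -> : #|{: big_class}| = \sum_p (2 <= nedges (comp_rel p)).
  by rewrite card_sig -sum_mem; apply: eq_bigr => p _; rewrite inE.
have -> : \sum_(i : big_class) nedges (comp_rel (val i)) =
    \sum_p (2 <= nedges (comp_rel p)) * nedges (comp_rel p).
  rewrite -(big_sub (mem big_classes) (fun p => nedges (comp_rel p))) big_mkcond.
  by apply: eq_bigr => p _; rewrite inE; case: ifP; rewrite ?mul1n.
have := sum_comp_edges; have := ncolours_le; rewrite -sum_mem.
(* A class with one edge adds 1 to the number of classes and 1 to the number of edges, so the bound
   for the big classes carries over. *)
have : \sum_p (p \in [set p | 0 < nedges (comp_rel p)]) +
    \sum_p (2 <= nedges (comp_rel p)) * nedges (comp_rel p) =
    \sum_p nedges (comp_rel p) + \sum_p (2 <= nedges (comp_rel p)).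
  rewrite -!big_split; apply: eq_bigr => p _ /=; rewrite inE.
  by case: (nedges _) => [|[|N]] //=; lia.
move: (\sum_p _) (\sum_p nedges _) (\sum_p _) (\sum_p _) => a b c' d'; lia.
Qed.
End Components.

Theorem theorem3p1 (T : finType) (e h : rel T) (k : nat) :
  k \in [:: 2; 3; 4; 5] ->
  k < #|T| ->
  simple_graph e ->
  k_connected k e ->
  min_spanning_k_connected k e h ->
  nedges h = (k * #|T|).+1 %/ 2 ->
  mc_k_is k e (nedges e - (k * #|T|).+1 %/ 2 + 1).
Proof.
move=> k25 kn [e_sym e_irr] _ [[h_sym he] [h_conn _]] eh.
have k2_5 : 2 <= k <= 5 by move: k25; rewrite !inE => /or4P[]/eqP->.
have h_gt0 : 0 < nedges h by rewrite eh; case/andP: k2_5 => k2 _; nia.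
split.
  exists (spanning_colouring e h); split.
    exact: mono_k_connected_spanning_colouring.
  by rewrite ncolours_spanning_colouring // eh.
move=> c /(ncolours_bound e_sym e_irr k2_5 kn).
(* This makes the truncated subtraction exact; the ceiling arises from halving the doubled
   inequality. *)
have : nedges h <= nedges e by apply/subset_leq_card/edges_sub.
by rewrite eh; lia.
Qed.
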